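(* Let the symmetric group $S_d$ act on $\mathbb R^d$ by permuting coordinates, and let $\mathcal C^\infty_{S_d}$ be the ring of germs at $0$ of smooth $S_d$-invariant functions $f$ on $\mathbb R^d$ with $f(0)=0$ and $df(0)=0$. There is a constant $C$ independent of $d$ such that for every $d$, for an open and dense set of $f\in\mathcal C^\infty_{S_d}$, the germ at $0$ of the tangency set $\mho(f)$ consists of at most $C^d$ tangency arcs, and the isotropy group of every such tangency arc is conjugate in $S_d$ to $S_{d-q}\times S_q$ for some $0\le q\le\lfloor d/2\rfloor$.
   Context: Tangency set: $\mho(f)=\{x : D_if(x)\,x_j=D_jf(x)\,x_i \text{ for all } i,j\in[d]\}$. A tangency arc relative to $0$ is a continuous curve $\gamma:[0,\epsilon)\to\mathbb R^d$, $\epsilon>0$, with $\gamma(0)=0$ and $\gamma(t)\in\mho(f)\setminus\{0\}$ for $t>0$. The isotropy group of a point $x$ is $\{g\in S_d: gx=x\}$; the isotropy group of a tangency arc is the isotropy group of its points $\gamma(t)$ for $t>0$ small. Here $S_{d-q}\times S_q\le S_d$ is the subgroup preserving $\{1,\dots,d-q\}$ and $\{d-q+1,\dots,d\}$. The topology on $\mathcal C^\infty_{S_d}$ is induced by passing to germs (quotient topology) from the Whitney $C^\infty$ topology on invariant smooth functions vanishing together with their first derivatives at $0$. *)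

(* Defs.v *)
From HB Require Import structures.
From mathcomp Require Import all_boot all_order all_algebra all_fingroup.
From mathcomp Require Import generic_quotient.
From mathcomp Require Import all_classical all_reals all_analysis.

Set Implicit Arguments.
Unset Strict Implicit.
Unset Printing Implicit Defensive.

Import Order.TTheory GRing.Theory Num.Theory.
Import numFieldNormedType.Exports.

Local Open Scope classical_set_scope.
Local Open Scope ring_scope.

Section SmoothFunctions.
Context {R : realType} {d : nat}.
Implicit Types (f : 'rV[R]_d -> R) (x : 'rV[R]_d).

Definition partial (i : 'I_d) f : 'rV[R]_d -> R := 'D_(delta_mx 0 i) f.

Definition iter_partial (s : seq 'I_d) f : 'rV[R]_d -> R := foldr partial f s.

Definition smooth f : Prop := forall s x, differentiable (iter_partial s f) x.

Definition Sd_invariant f : Prop :=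
  forall (g : 'S_d) x, f (col_perm g x) = f x.

End SmoothFunctions.

Record invfun (R : realType) (d : nat) := InvFun {
  invfun_val :> 'rV[R]_d -> R ;
  invfun_smooth : smooth invfun_val ;
  invfun_inv : Sd_invariant invfun_val ;
  invfun_0 : invfun_val 0 = 0 ;
  invfun_d0 : forall i, partial i invfun_val 0 = 0 }.

HB.instance Definition _ (R : realType) (d : nat) := gen_eqMixin (invfun R d).
HB.instance Definition _ (R : realType) (d : nat) :=
  gen_choiceMixin (invfun R d).

Section Whitney.
Context {R : realType} {d : nat}.
Implicit Types (f g : invfun R d).

(* Strong C^r neighbourhood: delta is an arbitrary positive continuous function
   on the whole of R^d, and may decay at infinity. *)
Definition whitney_nbhd (r : nat) (delta : 'rV[R]_d -> R) f : set (invfun R d) :=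
  [set g | forall s : seq 'I_d, (size s <= r)%N ->
     forall x, `|iter_partial s g x - iter_partial s f x| < delta x].

(* The Whitney C^oo topology is the union of the Whitney C^r topologies. *)
Definition whitney_open : set_system (invfun R d) :=
  [set W | forall f, W f -> exists (r : nat) (delta : 'rV[R]_d -> R),
     [/\ continuous delta, forall x, 0 < delta x
       & whitney_nbhd r delta f `<=` W]].

Lemma whitney_openT : whitney_open setT.
Proof.
by move=> f _; exists 0%N, (cst 1); split => //; exact: cst_continuous.
Qed.

Lemma whitney_openI : setI_closed whitney_open.
Proof.
move=> A B oA oB f [/oA[r1 [d1 [c1 p1 s1]]] /oB[r2 [d2 [c2 p2 s2]]]].
exists (maxn r1 r2), (fun x => Num.min (d1 x) (d2 x)); split.
- by move=> x; apply: continuous_min; [exact: c1|exact: c2].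
- by move=> x; rewrite lt_min p1 p2.
- move=> g H; split; [apply: s1|apply: s2] => s hs x.
  + have := H s (leq_trans hs (leq_maxl _ _)) x.
    by rewrite lt_min => /andP[].
  + have := H s (leq_trans hs (leq_maxr _ _)) x.
    by rewrite lt_min => /andP[].
Qed.

Lemma whitney_open_bigU (I : Type) (F : I -> set (invfun R d)) :
  (forall i, whitney_open (F i)) -> whitney_open (\bigcup_i F i).
Proof.
move=> oF f [i _ /oF[r [delta [c p s]]]].
by exists r, delta; split => // g /s Fg; exists i.
Qed.

End Whitney.

HB.instance Definition _ (R : realType) (d : nat) :=
  isOpenTopological.Build (invfun R d)
    whitney_openT whitney_openI whitney_open_bigU.

Section Germs.
Context (R : realType) (d : nat).

Definition same_germ (f g : invfun R d) : bool :=
  `[< \forall x \near (0 : 'rV[R]_d), f x = g x >].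

Lemma same_germ_equiv : equiv_class_of same_germ.
Proof.
split.
- by move=> f; apply/asboolP; near=> x.
- move=> f g; apply/asboolP/asboolP; apply: filterS => x -> //.
- move=> f g h /asboolP fg /asboolP gh; apply/asboolP.
  by apply: filterS2 fg gh => x -> ->.
Unshelve. all: by end_near. Qed.

Canonical same_germ_equiv_rel := EquivRelPack same_germ_equiv.

Definition invgerm := quotient_topology {eq_quot same_germ_equiv_rel}%qT.

Definition germ_of (f : invfun R d) : invgerm :=
  \pi_({eq_quot same_germ_equiv_rel}%qT)%qT f.

End Germs.

Section Tangency.
Context {R : realType} {d : nat}.
Implicit Types (f : 'rV[R]_d -> R) (x : 'rV[R]_d) (gamma : R -> 'rV[R]_d).

Definition tangency_set f : set 'rV[R]_d :=
  [set x | forall i j, partial i f x * x 0 j = partial j f x * x 0 i].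

(* Only the restriction of gamma to [0, eps) is meaningful. *)
Definition tangency_arc f (eps : R) gamma : Prop :=
  [/\ 0 < eps,
      {within `[0, eps[, continuous gamma},
      gamma 0 = 0
    & forall t : R, 0 < t < eps -> tangency_set f (gamma t) /\ gamma t != 0].

(* S and the union of the arcs have the same germ at 0.  Quantifying over rho
   makes this depend only on the germs at t = 0 of the curves: parts of an arc
   that come back close to 0 at later times do not count. *)
Definition germ_consists_of_arcs (S : set 'rV[R]_d) (N : nat)
    (eps : 'I_N -> R) (gamma : 'I_N -> R -> 'rV[R]_d) : Prop :=
  forall rho : R, 0 < rho -> \forall x \near (0 : 'rV[R]_d),
    S x <-> exists k (t : R), [/\ 0 <= t, t < eps k, t < rho & gamma k t = x].

Definition isotropy x : {set 'S_d} := [set g : 'S_d | col_perm g x == x]%SET.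

Definition arc_isotropy gamma (G : {set 'S_d}) : Prop :=
  \forall t \near 0^'+, isotropy (gamma t) = G.

End Tangency.

(* S_{d-q} x S_q; preserving the first block forces preserving the second. *)
Definition young (d q : nat) : {set 'S_d} :=
  [set g : 'S_d | [forall i, (g i < d - q)%N == (i < d - q)%N]]%SET.

(* Main.v *)
(* The tangency condition at x says that grad f = lambda x.  For an invariant f
   the divided difference (D_i f - D_j f) / (x_i - x_j) extends continuously to
   x_i = x_j, and at a tangency point it equals lambda whenever x_i <> x_j.
   Comparing two such divided differences, the second order divided difference
   would vanish if three coordinates were distinct; its value at 0 is a linear
   form in the 3-jet of f, generically nonzero.  So tangency points close to 0
   have at most two distinct coordinates, t + b on a set I and b outside I.  For
   fixed I and t > 0, tangency is one equation in b whose derivative in b at 0 is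
   a linear form in the 2-jet of f, again generically nonzero; it has a unique
   small solution b(t) = O(t), which yields one arc for each subset I, hence 2^d
   arcs in all.  The stabilizer of I is the isotropy group.

   Genericity concerns the 3-jet at 0 only, which gives openness; density follows
   by adding a small multiple of p_1^2 + p_3 cut off outside the unit ball, so
   that Whitney neighbourhoods with decaying radius cause no trouble. *)
Require Import Defs.
From HB Require Import structures.
From mathcomp Require Import all_boot all_order all_algebra all_fingroup.
From mathcomp Require Import all_classical all_reals all_analysis.
From mathcomp Require Import zify ring lra.

Set Implicit Arguments.
Unset Strict Implicit.
Unset Printing Implicit Defensive.

Import Order.TTheory GRing.Theory Num.Theory.
Import numFieldNormedType.Exports.

Local Open Scope classical_set_scope.
Local Open Scope ring_scope.

(** * Calculus along lines and under permutations of the coordinates *)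

Section Calculus.
Context {R : realType} {d : nat}.
Implicit Types (w f : 'rV[R]_d -> R) (x v : 'rV[R]_d) (g : 'S_d).

Lemma is_derive_line w x v (s : R) : differentiable w (x + s *: v) ->
  is_derive s 1 (fun s => w (x + s *: v))
    (\sum_i v 0 i * partial i w (x + s *: v)).
Proof.
move=> dw.
have dl : is_diff s (fun s : R => x + s *: v) (fun h => h *: v).
  apply: is_diff_eq.
  by apply/funext => h /=; rewrite add0r.
have dc : differentiable (w \o (fun s : R => x + s *: v)) s.
  by apply: differentiable_comp.
have -> : (fun s => w (x + s *: v)) = w \o (fun s : R => x + s *: v) by [].
apply: DeriveDef; first exact/diff_derivable.
rewrite deriveE// diff_comp// diff_val /= scale1r.
have -> : \sum_i v 0 i * partial i w (x + s *: v) =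
    'd w (x + s *: v) (\sum_i v 0 i *: delta_mx 0 i).
  rewrite linear_sum; apply: eq_bigr => i _.
  by rewrite linearZ /= /partial deriveE.
by rewrite -row_sum_delta.
Qed.

Lemma mean_value_line w x v : (forall y, differentiable w y) ->
  exists2 th : R, 0 < th < 1 &
    w (x + v) - w x = \sum_i v 0 i * partial i w (x + th *: v).
Proof.
move=> dw.
have H s := is_derive_line (dw (x + s *: v)).
have cl : {within `[0, 1], continuous (fun s : R => w (x + s *: v))}.
  by apply: derivable_within_continuous => s _; have [] := H s.
have [th] := MVT (@ltr01 R) (fun s _ => H s) cl.
rewrite in_itv /= => thI.
rewrite scale1r scale0r addr0 subr0 mulr1 => E.
by exists th.
Qed.

Lemma norm_coord x (i : 'I_d) : `|x 0 i| <= `|x|.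
Proof.
rewrite [leRHS]mx_normrE.
exact: (le_bigmax (0 : R) (fun ij : 'I_1 * 'I_d => `|x ij.1 ij.2|) (0, i)).
Qed.

Lemma norm_le_coord x (M : R) : 0 <= M -> (forall i, `|x 0 i| <= M) ->
  `|x| <= M.
Proof.
move=> M0 H; rewrite [leLHS]mx_normrE; apply: bigmax_le => // -[i j] _ /=.
by rewrite (ord1 i).
Qed.

Lemma norm_col_perm g x : `|col_perm g x| = `|x|.
Proof.
apply/eqP; rewrite eq_le; apply/andP; split; apply: norm_le_coord => // i.
  by rewrite mxE norm_coord.
by have := norm_coord (col_perm g x) (g^-1%g i); rewrite mxE permKV.
Qed.

Lemma norm_segment x y (th r : R) : 0 <= th <= 1 -> `|x| <= r -> `|y| <= r ->
  `|x + th *: (y - x)| <= r.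
Proof.
move=> /andP[t0 t1] xr yr.
have -> : x + th *: (y - x) = (1 - th) *: x + th *: y.
  by rewrite scalerBr scalerBl scale1r addrCA addrC.
rewrite (le_trans (ler_normD _ _))// !normrZ !ger0_norm ?subr_ge0//.
nra.
Qed.

(** [col_perm g] carries the basis vector of index [g i] to that of index [i]; this is the index
    shift between the two sides. *)
Lemma partial_col_perm w1 w2 g : (forall x, w1 x = w2 (col_perm g x)) ->
  forall i x, partial (g i) w1 x = partial i w2 (col_perm g x).
Proof.
move=> H i x; rewrite /partial /derive.
suff -> : (fun h : R => h^-1 *: ((w1 \o shift x) (h *: delta_mx 0 (g i)) - w1 x))
  = (fun h : R => h^-1 *: ((w2 \o shift (col_perm g x)) (h *: delta_mx 0 i) -
                          w2 (col_perm g x))) by [].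
apply/funext => h /=; rewrite !H; congr (_ *: (w2 _ - _)).
apply/rowP => j; rewrite !mxE /=.
by rewrite (inj_eq perm_inj).
Qed.

Lemma iter_partial_col_perm f g (s : seq 'I_d) x : Sd_invariant f ->
  iter_partial (map g s) f x = iter_partial s f (col_perm g x).
Proof.
move=> fS; elim: s x => [|i s IH] x /=; first by rewrite fS.
exact: partial_col_perm.
Qed.

Lemma smooth_iter_partial f s : smooth f -> smooth (iter_partial s f).
Proof.
by move=> sf s' x; rewrite /iter_partial -foldr_cat; exact: (sf (s' ++ s)).
Qed.

Lemma iter_partial_continuous f s : smooth f -> continuous (iter_partial s f).
Proof. by move=> sf x; exact/differentiable_continuous. Qed.

(** A vector minus its transposed image is (x_i - x_j)(e_i - e_j), so only two terms survive. *)
Lemma sum_swap x (i j : 'I_d) (F : 'I_d -> R) : i != j ->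
  \sum_l (x - col_perm (tperm i j) x) 0 l * F l = (x 0 i - x 0 j) * (F i - F j).
Proof.
move=> ij; rewrite (bigD1 i)//= (bigD1 j) 1?eq_sym//= big1.
  by rewrite !mxE tpermL tpermR addr0; ring.
by move=> k /andP[ki kj]; rewrite !mxE tpermD 1?eq_sym// subrr mul0r.
Qed.

(** Divisions by x_i - x_j are controlled this way: the quotient becomes a difference of derivatives
    at a point of the same ball, permutations being isometries of the sup norm and balls being
    convex. *)
Lemma swap_mean_value w (i j : 'I_d) x : i != j ->
  (forall y, differentiable w y) ->
  exists2 y, `|y| <= `|x| &
    w x - w (col_perm (tperm i j) x) =
      (x 0 i - x 0 j) * (partial i w y - partial j w y).
Proof.
move=> ij dw; set x' := col_perm _ x.
have [th /andP[t0 t1]] := mean_value_line x' (x - x') dw.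
rewrite (addrC x' (x - x')) subrK => E; exists (x' + th *: (x - x')).
  by apply: norm_segment; rewrite ?norm_col_perm// !ltW.
by rewrite E sum_swap.
Qed.

(** Equality near x holds near every point close to x ([near_join]), so it survives
    differentiation. *)
Lemma near_partial w1 w2 (x : 'rV[R]_d) (s : seq 'I_d) :
  (\forall y \near x, w1 y = w2 y) ->
  \forall y \near x, iter_partial s w1 y = iter_partial s w2 y.
Proof.
move=> H; elim: s => [|i s IH] //=.
move/near_join: IH; apply: filterS => y Hy.
exact: near_eq_derive.
Qed.

Lemma near_norm_lt (P : 'rV[R]_d -> Prop) :
  (\forall x \near (0 : 'rV[R]_d), P x) <->
  (exists2 r : R, 0 < r & forall x, `|x| < r -> P x).
Proof. by rewrite nbhs_norm0P. Qed.

End Calculus.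

(** This differentiates the auxiliary function [H] of the three-values argument; the bracket is the
    primitive of t a + (1 - t) b - c that vanishes at 0. *)
Lemma is_derive_quadratic_comb (R : realType) (F G : R -> R) (s u v m p q a b c : R) :
  is_derive s 1 F p -> is_derive s 1 G q ->
  is_derive s 1 (fun t => u * F t - v * G t
     - m * (t ^+ 2 / 2 * a + (t - t ^+ 2 / 2) * b - t * c))
    (u * p - v * q - m * (s * a + (1 - s) * b - c)).
Proof.
move=> dF dG.
have -> : (fun t => u * F t - v * G t
     - m * (t ^+ 2 / 2 * a + (t - t ^+ 2 / 2) * b - t * c)) =
   u *: F - v *: G - m *: ((a / 2 - b / 2) *: (id : R -> R) ^+ 2 + (b - c) *: id).
  apply/funext => t.
  transitivity (u * F t - v * G t - m * ((a / 2 - b / 2) * t ^+ 2 + (b - c) * t)).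
    by field.
  by rewrite !fctE.
have did := is_derive_id s (1 : R).
apply: is_derive_eq (is_deriveB
  (is_deriveB (is_deriveZ u dF) (is_deriveZ v dG))
  (is_deriveZ m (is_deriveD (is_deriveZ (a / 2 - b / 2) (is_deriveX 2 did))
                            (is_deriveZ (b - c) did)))) _.
by rewrite /GRing.scale /=; field.
Qed.

(** * At most two distinct coordinates at tangency points near 0 *)

Section TwoValues.
Context {R : realType} {d : nat}.
Implicit Types (f w : 'rV[R]_d -> R) (x v : 'rV[R]_d).

(** With psi = D_i D_i f - D_j D_i f, this is the integral over [0, 1] of s D_i psi(0) + (1 - s) D_j
    psi(0) - D_k psi(0); the 2 comes from the mean of s. *)
Definition cubic_jet f (i j k : 'I_d) : R :=
  (iter_partial [:: i; i; i] f 0 - iter_partial [:: i; j; i] f 0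
   + (iter_partial [:: j; i; i] f 0 - iter_partial [:: j; j; i] f 0)) / 2
  - (iter_partial [:: k; i; i] f 0 - iter_partial [:: k; j; i] f 0).

Lemma tangent_multiplier f x : tangency_set f x -> x != 0 ->
  exists lam : R, forall i, partial i f x = lam * x 0 i.
Proof.
move=> xf /eqP x0.
have [[m xm]|] := pselect (exists m, x 0 m != 0).
  by exists (partial m f x / x 0 m) => i; rewrite mulrAC -(xf i m) mulfK.
move=> H; exfalso; apply: x0; apply/rowP => i; rewrite mxE.
by apply/eqP; apply: contra_notT H => xi; exists i.
Qed.

(* With psi = D_i D_i f - D_j D_i f, the difference of the divided differences
   (D_i f - D_j f) / (x_i - x_j) and (D_k f - D_j f) / (x_k - x_j) is
   (x_i - x_k) \int_0^1 (s D_i psi + (1 - s) D_j psi - D_k psi) ds, the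
   integrand being evaluated near 0; both equal the multiplier at a tangency
   point.  The integral is avoided by applying the mean value theorem to the
   difference with its limit value. *)
Lemma tangency_three_values f (i j k : 'I_d) : smooth f -> Sd_invariant f ->
  i != j -> i != k -> j != k -> cubic_jet f i j k != 0 ->
  \forall x \near (0 : 'rV[R]_d), tangency_set f x ->
    [|| x 0 i == x 0 j, x 0 i == x 0 k | x 0 j == x 0 k].
Proof.
move=> sf fS ij ik jk c0.
pose w := partial i f.
pose psi := partial i w \- partial j w.
have [ji ki kj] : [/\ j != i, k != i & k != j] by rewrite !(eq_sym _ i) !(eq_sym k).
have dpart s y : differentiable (iter_partial s f) y by exact: sf.
have dw y : differentiable w y by exact: (dpart [:: i]).
have dpsi y : differentiable psi y.
  by apply: differentiableB; [exact: (dpart [:: i; i])|exact: (dpart [:: j; i])].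
have psiE l y : partial l psi y =
    iter_partial [:: l; i; i] f y - iter_partial [:: l; j; i] f y.
  rewrite /partial deriveB//; apply: diff_derivable.
    exact: (dpart [:: i; i]).
  exact: (dpart [:: j; i]).
(* A tolerance |c| / 4 on each of three derivatives of psi leaves a total error below |c| / 2, which
   will contradict an identity with left side -c. *)
pose c := cubic_jet f i j k.
have e0 : 0 < `|c| / 4 by rewrite divr_gt0// normr_gt0.
have cpsi l : \forall y \near (0 : 'rV[R]_d),
    `|partial l psi y - partial l psi 0| < `|c| / 4.
  have cl : partial l psi @ (0 : 'rV[R]_d) --> partial l psi 0.
    have -> : partial l psi = iter_partial [:: l; i; i] f \- iter_partial [:: l; j; i] f.
      by apply/funext => y; rewrite psiE.
    have ct s : continuous (iter_partial s f) by exact: iter_partial_continuous.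
    exact: cvgB (ct _ _) (ct _ _).
  have H := (@cvgrPdist_lt _ _ _ _ _ _ _).1 cl (`|c| / 4) e0.
  by near=> y; rewrite distrC; near: y; exact: H.
have /near_norm_lt[r r0 Hr] := cpsi i.
have /near_norm_lt[r' r'0 Hr'] := cpsi j.
have /near_norm_lt[r'' r''0 Hr''] := cpsi k.
apply/near_norm_lt; exists (Num.min r (Num.min r' r'')).
  by rewrite !lt_min r0 r'0.
move=> x; rewrite !lt_min => /and3P[xr xr' xr''] tx.
apply/negPn/negP; rewrite !negb_or => /and3P[xij xik xjk].
have x0 : x != 0 by apply: contra_neq xij => ->; rewrite !mxE.
have [lam Hlam] := tangent_multiplier tx x0.
pose a := x 0 i; pose b := x 0 j; pose e := x 0 k.
(* The transpositions turn D_j f and D_k f at x into values of the single function w = D_i f. Both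
   divided differences become increments of w along segments parallel to e_i - e_j, from y0 to x and
   from z0 to z1. *)
pose y0 := col_perm (tperm i j) x.
pose z1 := col_perm (tperm i k) x.
pose z0 := col_perm (tperm i j) z1.
have wy1 : w x = lam * a by rewrite /w Hlam.
have wy0 : w y0 = lam * b.
  rewrite /w /y0; have := iter_partial_col_perm (tperm i j) [:: i] x fS.
  by rewrite /= tpermL => <-; rewrite Hlam.
have wz1 : w z1 = lam * e.
  rewrite /w /z1; have := iter_partial_col_perm (tperm i k) [:: i] x fS.
  by rewrite /= tpermL => <-; rewrite Hlam.
have wz0 : w z0 = lam * b.
  rewrite /w /z0; have := iter_partial_col_perm (tperm i j) [:: i] z1 fS.
  rewrite /= tpermL => <-.
  have := iter_partial_col_perm (tperm i k) [:: j] x fS.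
  by rewrite /= tpermD// => <-; rewrite Hlam.
have z1i : z1 0 i = e by rewrite mxE tpermL.
have z1j : z1 0 j = b by rewrite mxE tpermD.
have z1k : z1 0 k = a by rewrite mxE tpermR.
have [P PE] : exists P, forall l, P l = partial l psi 0 by exists (fun l => partial l psi 0).
(* The two quotients both increase by [lam] between s = 0 and s = 1 and cancel, so H(1) - H(0) = -(a
   - e) c. *)
pose H (s : R) := (a - b)^-1 * w (y0 + s *: (x - y0))
  - (e - b)^-1 * w (z0 + s *: (z1 - z0))
  - (a - e) * (s ^+ 2 / 2 * P i + (s - s ^+ 2 / 2) * P j - s * P k).
have ab0 : a - b != 0 by rewrite subr_eq0.
have eb0 : e - b != 0 by rewrite subr_eq0 eq_sym.
have ae0 : a - e != 0 by rewrite subr_eq0.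
have dH (s : R) : is_derive s (1 : R) H (psi (y0 + s *: (x - y0))
   - psi (z0 + s *: (z1 - z0)) - (a - e) * (s * P i + (1 - s) * P j - P k)).
  have D1 : is_derive s (1 : R) (fun s : R => w (y0 + s *: (x - y0)))
      ((a - b) * psi (y0 + s *: (x - y0))).
    exact: is_derive_eq (is_derive_line (dw _)) (sum_swap x _ ij).
  have D2 : is_derive s (1 : R) (fun s : R => w (z0 + s *: (z1 - z0)))
      ((e - b) * psi (z0 + s *: (z1 - z0))).
    rewrite -z1i -z1j.
    exact: is_derive_eq (is_derive_line (dw _)) (sum_swap z1 _ ij).
  have := is_derive_quadratic_comb (a - b)^-1 (e - b)^-1 (a - e) (P i) (P j) (P k) D1 D2.
  by rewrite !mulKf.
have cH : {within `[0, 1], continuous H}.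
  by apply: derivable_within_continuous => s _; have [] := dH s.
have [s] := MVT (@ltr01 R) (fun s _ => dH s) cH; clear dH cH.
rewrite in_itv /= => /andP[s0 s1].
rewrite subr0 mulr1 {1 2}/H !scale1r !scale0r !addr0.
have addBK (u v : 'rV[R]_d) : u + (v - u) = v by rewrite addrC subrK.
rewrite !addBK wy1 wy0 wz1 wz0.
set ys := y0 + _; set zs := z0 + _.
(* A second mean value theorem compares psi at the two moving points, whose difference is (a - e)(s
   e_i + (1 - s) e_j - e_k). *)
have [th /andP[t0 t1]] := mean_value_line zs (ys - zs) dpsi.
rewrite addBK => ->.
set xi := zs + _.
have nxi : `|xi| <= `|x|.
  by apply: norm_segment; rewrite ?(ltW t0) ?(ltW t1)//; apply: norm_segment;
    rewrite ?(ltW s0) ?(ltW s1) ?norm_col_perm.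
have -> : \sum_l (ys - zs) 0 l * partial l psi xi =
    (a - e) * (s * partial i psi xi + (1 - s) * partial j psi xi
               - partial k psi xi).
  rewrite (bigD1 i)//= (bigD1 j)//= (bigD1 k); last by rewrite ki kj.
  rewrite big1 /=.
    have -> : (ys - zs) 0 i = (a - e) * s.
      by rewrite !mxE !(tpermL, tpermR) (tpermD (x := i) (y := k) (z := j))// /a /e; ring.
    have -> : (ys - zs) 0 j = (a - e) * (1 - s).
      by rewrite !mxE !(tpermL, tpermR) (tpermD (x := i) (y := k) (z := j))// /a /e; ring.
    have -> : (ys - zs) 0 k = (a - e) * - 1.
      by rewrite !mxE !(tpermD (x := i) (y := j) (z := k))// tpermR /a /e; ring.
    by move: (partial i _ _) (partial j _ _) (partial k _ _) => ? ? ?; ring.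
  move=> l /andP[/andP[li lj] lk].
  have -> : (ys - zs) 0 l = 0 by rewrite !mxE !tpermD 1?eq_sym//; ring.
  exact: mul0r.
have Pi := Hr xi (le_lt_trans nxi xr).
have Pj := Hr' xi (le_lt_trans nxi xr').
have Pk := Hr'' xi (le_lt_trans nxi xr'').
rewrite -!PE in Pi Pj Pk.
have cE : c = (P i + P j) / 2 - P k by rewrite /c /cubic_jet !PE !psiE.
move: (partial i psi xi) (partial j psi xi) (partial k psi xi) Pi Pj Pk.
move=> Qi Qj Qk Pi Pj Pk E.
(* Division by a - e, nonzero since x_i and x_k differ, expresses c through the variations of the
   derivatives of psi between 0 and xi. *)
have {}E : - c = s * (Qi - P i) + (1 - s) * (Qj - P j)
   - (Qk - P k).
  apply: (mulfI ae0); rewrite cE.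
  apply: (eq_trans (y := (a - b)^-1 * (lam * a) - (e - b)^-1 * (lam * e)
    - (a - e) * (1 ^+ 2 / 2 * P i + (1 - 1 ^+ 2 / 2) * P j - 1 * P k)
    - ((a - b)^-1 * (lam * b) - (e - b)^-1 * (lam * b)
    - (a - e) * (0 ^+ 2 / 2 * P i + (0 - 0 ^+ 2 / 2) * P j - 0 * P k)))).
    by field; rewrite ab0 eb0.
  by rewrite E; ring.
have : `|c| < `|c|.
  rewrite -[X in X < _]normrN E.
  rewrite (le_lt_trans (ler_normB _ _))//.
  rewrite (le_lt_trans (lerD (ler_normD _ _) (lexx _)))//.
  rewrite !normrM (gtr0_norm s0) (@gtr0_norm _ (1 - s)) ?subr_gt0//.
  have Hi : s * `|Qi - P i| <= s * (`|c| / 4) by rewrite ler_wpM2l ?ltW.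
  have Hj : (1 - s) * `|Qj - P j| <= (1 - s) * (`|c| / 4).
    by rewrite ler_wpM2l ?subr_ge0 ?ltW.
  lra.
by rewrite ltxx.
Unshelve. all: by end_near. Qed.

End TwoValues.

(** * A one-dimensional implicit function theorem *)

Section Branch.
Context {R : realType}.

(** The branch must reach t = 0, where nothing is assumed of E. As b -> E t b - kappa b is Lipschitz
    with constant |kappa| / 2, the intermediate value theorem gives a zero of E t on [-r, r], and
    this zero lies within (2 / |kappa|) |E t c| of any c in that interval; uniqueness and continuity
    in t follow. *)
Lemma implicit_branch (E : R -> R -> R) (kappa r K : R) :
  kappa != 0 -> 0 < r -> 0 < K ->
  (forall t b c, 0 < t < r -> `|b| <= r -> `|c| <= r ->
     `|E t b - E t c - kappa * (b - c)| <= `|kappa| / 2 * `|b - c|) ->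
  (forall t, 0 < t < r -> `|E t 0| <= K * t) ->
  (forall t b, 0 < t -> {for t, continuous (E ^~ b)}) ->
  (forall t, 0 < t -> continuous (E t)) ->
  exists (eps : R) (beta : R -> R),
    [/\ 0 < eps <= r,
        {in `[0, eps[%R, continuous beta},
        forall t, `|t| < eps -> `|beta t| <= 2 * K / `|kappa| * `|t|,
        forall t, 0 < t < eps -> E t (beta t) = 0
      & forall t b, 0 < t < eps -> `|b| <= r -> E t b = 0 -> b = beta t].
Proof.
move=> k0 r0 K0 HE HE0 cEt cEb.
have kp : 0 < `|kappa| by rewrite normr_gt0.
(* For t < eps, K t < |kappa| r / 2, so the error |kappa| r / 2 + K t in approximating E t b by
   kappa b cannot change the sign at b = r or b = -r. *)
pose eps := Num.min r (`|kappa| * r / (2 * K)).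
have e0 : 0 < eps by rewrite lt_min r0 divr_gt0 ?mulr_gt0.
have er : eps <= r by rewrite ge_min lexx.
have eK t : t < eps -> K * t < `|kappa| * r / 2.
  rewrite lt_min => /andP[_]; rewrite ltr_pdivlMr ?mulr_gt0// => H.
  by rewrite ltr_pdivlMr// (le_lt_trans _ H)//; lra.
have bound t b : 0 < t < eps -> `|b| <= r -> E t b = 0 ->
    `|b| <= 2 * K / `|kappa| * t.
  move=> /andP[t0 te] br Eb.
  have tr : 0 < t < r by rewrite t0 (lt_le_trans te er).
  have := HE t b 0 tr br; rewrite normr0 => /(_ (ltW r0)).
  rewrite Eb !subr0 sub0r -opprD normrN => H.
  have H1 : `|kappa * b| <= K * t + `|kappa| / 2 * `|b|.
    have -> : kappa * b = (E t 0 + kappa * b) - E t 0 by ring.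
    rewrite (le_trans (ler_normB _ _))//.
    by have := HE0 t tr; lra.
  rewrite normrM in H1.
  rewrite mulrAC ler_pdivlMr//; lra.
have ex t : exists b, 0 < t < eps -> `|b| <= r /\ E t b = 0.
  have [/andP[t0 te]|nt] := boolP (0 < t < eps); last by exists 0.
  have tr : 0 < t < r by rewrite t0 (lt_le_trans te er).
  have nr : `|r| <= r by rewrite gtr0_norm.
  have nNr : `|- r| <= r by rewrite normrN gtr0_norm.
  have := HE t r 0 tr nr; rewrite normr0 => /(_ (ltW r0)); rewrite subr0.
  have := HE t (- r) 0 tr nNr; rewrite normr0 => /(_ (ltW r0)); rewrite subr0.
  rewrite normrN (gtr0_norm r0) !ler_norml.
  have := HE0 t tr; have := eK t te; rewrite ler_norml => h1 h2 h3 h4.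
  have [|||b] := @IVT R (E t) (- r) r 0.
  - lra.
  - exact/continuous_subspaceT/cEb.
  - rewrite ge_min le_max.
    case: (ltrP 0 kappa) h1 h2 h3 h4 => [kpos|kneg].
      rewrite gtr0_norm// => h1 h2 h3 h4.
      by apply/andP; split; apply/orP; [left|right]; nra.
    rewrite ler0_norm// => h1 h2 h3 h4.
    by apply/andP; split; apply/orP; [right|left]; nra.
  rewrite in_itv /= => bI Eb; exists b => _; split => //.
  by rewrite ler_norml.
have [b Hb] := choice ex.
(* The value 0 for t <= 0 extends the linear bound to both sides of 0, whence continuity there. *)
pose beta t := if 0 < t then b t else 0.
have betaE t : 0 < t -> beta t = b t by rewrite /beta => ->.
have Hbeta t : `|t| < eps -> `|beta t| <= 2 * K / `|kappa| * `|t|.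
  rewrite /beta; case: (ltrP 0 t) => [t0|t0] te; last first.
    by rewrite normr0 !mulr_ge0 ?invr_ge0// ltW.
  move: te; rewrite gtr0_norm// => te.
  have tt : 0 < t < eps by rewrite t0.
  by have [h1 h2] := Hb t tt; exact: bound.
have sep t c c' : 0 < t < eps -> `|c| <= r -> `|c'| <= r -> E t c = 0 ->
    `|c - c'| <= 2 / `|kappa| * `|E t c'|.
  move=> /andP[t0 te] cr cr' Ec.
  have tr : 0 < t < r by rewrite t0 (lt_le_trans te er).
  have := HE t c c' tr cr cr'; rewrite Ec sub0r => H.
  have H1 : `|kappa * (c - c')| <= `|E t c'| + `|kappa| / 2 * `|c - c'|.
    have -> : kappa * (c - c') = - E t c' - (- E t c' - kappa * (c - c')) by ring.
    rewrite (le_trans (ler_normB _ _))// normrN.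
    by rewrite lerD2l.
  rewrite normrM in H1.
  rewrite mulrAC ler_pdivlMr//; lra.
exists eps, beta; split => //.
- by rewrite e0.
- move=> t; rewrite in_itv /= => /andP[]; rewrite le_eqVlt => /orP[/eqP <- _|t0 te].
    have b0 : beta 0 = 0 by rewrite /beta ltxx.
    apply/cvgrPdist_le => e ep; rewrite b0.
    have e1 : 0 < e / (2 * K / `|kappa|) by rewrite !divr_gt0// mulr_gt0.
    have near_lt (y : R) : 0 < y -> \forall s \near (0 : R), `|s| < y.
      by move=> y0; exact: (@pseudometric_normed_Zmodule.nbhs0_lt _ R).
    near=> s.
    have s1 : `|s| < eps by near: s; exact: near_lt.
    have s2 : `|s| < e / (2 * K / `|kappa|) by near: s; exact: near_lt.
    rewrite sub0r normrN (le_trans (Hbeta _ s1))//.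
    by rewrite mulrC -ler_pdivlMr ?ltW// !divr_gt0// mulr_gt0.
  have tt : 0 < t < eps by rewrite t0.
  have [br Eb] := Hb t tt.
  (* The zero b(t), kept fixed, is almost a zero at nearby times s; [sep] at time s then brings b(s)
     close to it. *)
  have cE : (E ^~ (b t)) s @[s --> t] --> (0 : R).
    by rewrite -Eb; exact: cEt.
  apply/cvgrPdist_le => e ep.
  have e1 : 0 < e / (2 / `|kappa|) by rewrite !divr_gt0.
  near=> s.
  have s0 : 0 < s < eps.
    near: s; apply: (@near_in_itvoo _ 0 eps); by rewrite in_itv.
  have [bs Es] := Hb s s0; have [s1 s2] := andP s0.
  rewrite !betaE// distrC (le_trans (sep _ _ _ s0 bs br Es))//.
  rewrite mulrC -ler_pdivlMr ?divr_gt0//.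
  have : `|0 - E s (b t)| <= e / (2 / `|kappa|).
    by near: s; move/cvgrPdist_le : cE; apply.
  by rewrite sub0r normrN.
- by move=> t /[dup] tt /andP[t0 _]; rewrite betaE//; have [] := Hb t tt.
- move=> t c /[dup] tt /andP[t0 _] cr Ec; rewrite betaE//.
  have [bs Es] := Hb t tt.
  have := sep t c (b t) tt cr bs Ec; rewrite Es normr0 mulr0 normr_le0.
  by rewrite subr_eq0 => /eqP.
Unshelve. all: by end_near. Qed.

End Branch.

(** * Two-block vectors and the scalar equation for tangency *)

Section TwoBlocks.
Context {R : realType} {d : nat}.
Implicit Types (f w : 'rV[R]_d -> R) (x : 'rV[R]_d) (I : {set 'I_d}).

Definition block_vec I : 'rV[R]_d := \row_k (k \in I)%:R.

Definition two_block I (t b : R) : 'rV[R]_d := t *: block_vec I + b *: const_mx 1.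

(** Limit at t = b = 0 of the b-derivative of the tangency equation: b moves along the all-ones
    vector, hence the sum over k, and (D_i f - D_j f) / t tends to D_i D_i f - D_j D_i f. For smooth
    invariant f and i <> j, the Hessian at 0 is alpha I + beta J with J the all-ones matrix, and the
    value is d beta. *)
Definition quadratic_jet f (i j : 'I_d) : R :=
  \sum_k iter_partial [:: k; j] f 0 - iter_partial [:: i; i] f 0
  + iter_partial [:: j; i] f 0.

Lemma two_blockE I t b k : two_block I t b 0 k = t * (k \in I)%:R + b.
Proof. by rewrite !mxE mulr1. Qed.

Lemma two_block_norm I t b : `|two_block I t b| <= `|t| + `|b|.
Proof.
apply: norm_le_coord => [|k]; first by rewrite addr_ge0.
rewrite two_blockE (le_trans (ler_normD _ _))// lerD2r normrM.
by case: (k \in I); rewrite ?normr1 ?normr0 ?mulr1 ?mulr0.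
Qed.

Lemma partial_two_block f I t b (k l : 'I_d) : Sd_invariant f ->
  (k \in I) = (l \in I) ->
  partial k f (two_block I t b) = partial l f (two_block I t b).
Proof.
move=> fS kl.
have := iter_partial_col_perm (tperm k l) [:: l] (two_block I t b) fS.
rewrite /= tpermR => ->; congr (partial l f _).
apply/rowP => m; rewrite mxE !two_blockE.
by case: tpermP => [->|->|//]; rewrite kl.
Qed.

(* On two-block vectors, with h = (D_i f - D_j f) / t, tangency amounts to
   D_j f = h b, and then D_i f = h (t + b); this is the equation whose leading
   term in b is [quadratic_jet f i j * b]. *)
Definition tangency_defect f I (i j : 'I_d) (t b : R) : R :=
  partial j f (two_block I t b)
  - b * ((partial i f (two_block I t b) - partial j f (two_block I t b)) / t).

(** By invariance the derivatives of f agree within each block, so one index from each block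
    suffices; the multiplier is then h = (D_i f - D_j f) / t. *)
Lemma tangency_defectP f I (i j : 'I_d) (t b : R) : Sd_invariant f ->
  i \in I -> j \notin I -> t != 0 ->
  tangency_set f (two_block I t b) <-> tangency_defect f I i j t b = 0.
Proof.
move=> fS iI jI t0; rewrite /tangency_defect; set x := two_block I t b.
have xi : x 0 i = t + b by rewrite two_blockE iI mulr1.
have xj : x 0 j = b by rewrite two_blockE (negbTE jI) mulr0 add0r.
have [lI lJ] : (forall l, l \in I -> partial l f x = partial i f x) /\
               (forall l, l \notin I -> partial l f x = partial j f x).
  by split=> l lI; apply: partial_two_block => //; rewrite ?iI ?lI// (negbTE jI);
    exact: negbTE.
move: (partial i f x) (partial j f x) lI lJ => Di Dj lI lJ.
split.
  move=> /(_ i j); rewrite lI// lJ// xi xj => H.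
  by apply: (mulIf t0); rewrite mul0r mulrBl -!mulrA mulVf// mulr1 mulrBr; nra.
move=> H.
pose h := (Di - Dj) / t.
have DjE : Dj = h * b by rewrite /h mulrC; apply/eqP; rewrite -subr_eq0 H.
have DiE : Di = h * (t + b).
  by rewrite mulrDr -DjE /h divfK//; ring.
have lE l : partial l f x = h * x 0 l.
  have [lin|lnot] := boolP (l \in I).
    by rewrite lI// DiE two_blockE lin mulr1.
  by rewrite lJ// DjE two_blockE (negbTE lnot) mulr0 add0r.
by move=> k l; rewrite !lE; ring.
Qed.

Lemma swap_partial w (i j : 'I_d) : Sd_invariant w ->
  forall x, partial j w x = partial i w (col_perm (tperm i j) x).
Proof.
by move=> wS x; have := iter_partial_col_perm (tperm i j) [:: i] x wS; rewrite /= tpermL.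
Qed.

Lemma is_derive_two_block w I t b : (forall y, differentiable w y) ->
  is_derive b (1 : R) (fun b : R => w (two_block I t b))
    (\sum_k partial k w (two_block I t b)).
Proof.
move=> dw; apply: is_derive_eq; first exact: (is_derive_line (dw _)).
by apply: eq_bigr => k _; rewrite mxE mul1r.
Qed.

Lemma smooth_sum (n : nat) (F : 'I_n -> 'rV[R]_d -> R) :
  (forall k, smooth (F k)) -> smooth (fun x => \sum_k F k x).
Proof.
move=> sF s.
suff E : iter_partial s (fun x => \sum_k F k x) = \sum_k iter_partial s (F k).
  by move=> x; rewrite E; apply: differentiable_sum => k; exact: sF.
elim: s => [|i s IH] /=.
  by apply/funext => x; rewrite fct_sumE.
apply/funext => x; rewrite IH /partial derive_sum ?fct_sumE// => k.
exact/diff_derivable/sF.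
Qed.

Lemma iter_partialD w1 w2 s : smooth w1 -> smooth w2 ->
  iter_partial s (w1 \+ w2) = iter_partial s w1 \+ iter_partial s w2.
Proof.
move=> s1 s2; elim: s => [|i s IH] //=.
apply/funext => x; rewrite IH /partial.
by apply: deriveD; apply/diff_derivable; [exact: s1|exact: s2].
Qed.

Lemma iter_partialZ (a : R) w s : smooth w ->
  iter_partial s (a \*: w) = a \*: iter_partial s w.
Proof.
move=> sw; elim: s => [|i s IH] //=.
apply/funext => x; rewrite IH /partial.
by apply: deriveZ; apply/diff_derivable; exact: sw.
Qed.

Lemma smoothD w1 w2 : smooth w1 -> smooth w2 -> smooth (w1 \+ w2).
Proof.
by move=> s1 s2 s x; rewrite iter_partialD//; apply: differentiableD;
  [exact: s1|exact: s2].
Qed.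

Lemma smoothZ (a : R) w : smooth w -> smooth (a \*: w).
Proof.
by move=> sw s x; rewrite iter_partialZ//; apply: differentiableZ; exact: sw.
Qed.

Lemma near_ball_lt w (e : R) : continuous w -> 0 < e ->
  exists2 r : R, 0 < r & forall x, `|x| < r -> `|w x - w 0| < e.
Proof.
move=> cw e0; apply/near_norm_lt.
have H := (@cvgrPdist_lt _ _ _ _ _ _ _).1 (cw 0) e e0.
by near=> y; rewrite distrC; near: y; exact: H.
Unshelve. all: by end_near. Qed.

(** These are the estimates that [implicit_branch] asks for. The quotients by t = x_i - x_j in the
    b-derivative become differences of partial derivatives through [swap_mean_value], so this
    derivative stays close to kappa down to t = 0. *)
Lemma tangency_defect_near f I (i j : 'I_d) :
  smooth f -> Sd_invariant f -> i \in I -> j \notin I ->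
  quadratic_jet f i j != 0 -> (forall k, partial k f 0 = 0) ->
  exists r K : R, [/\ 0 < r, 0 < K,
    forall t b c, 0 < t < r -> `|b| <= r -> `|c| <= r ->
      `|tangency_defect f I i j t b - tangency_defect f I i j t c
        - quadratic_jet f i j * (b - c)|
      <= `|quadratic_jet f i j| / 2 * `|b - c|
  & forall t, 0 < t < r -> `|tangency_defect f I i j t 0| <= K * t].
Proof.
move=> sf fS iI jI k0 f0.
have ij : i != j by apply: contraNneq jI => <-.
set kappa := quadratic_jet f i j in k0 *.
have kp : 0 < `|kappa| / 8 by rewrite divr_gt0 ?normr_gt0.
pose w := partial i f; pose w' := partial j f.
have sw : smooth w by exact: (smooth_iter_partial [:: i] sf).
have sw' : smooth w' by exact: (smooth_iter_partial [:: j] sf).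
have dw y : differentiable w y by exact: (sw [::]).
have dw' y : differentiable w' y by exact: (sw' [::]).
(* S and S' are the derivatives of w and w' along the all-ones vector, the direction in which b
   moves; like w and w', they are exchanged by the transposition. *)
pose S x := \sum_k partial k w x.
pose S' x := \sum_k partial k w' x.
have sS : smooth S by apply: smooth_sum => k; exact: (smooth_iter_partial [:: k] sw).
have sS' : smooth S' by apply: smooth_sum => k; exact: (smooth_iter_partial [:: k] sw').
have wE x : w' x = w (col_perm (tperm i j) x) by exact: swap_partial.
have SE x : S' x = S (col_perm (tperm i j) x).
  rewrite /S' (reindex_inj (@perm_inj _ (tperm i j))).
  by apply: eq_bigr => k _; exact: partial_col_perm.
have dS y : differentiable S y by exact: (sS [::]).
have SdefE x : \sum_k partial k w x = S x by [].
have S'defE x : \sum_k partial k w' x = S' x by [].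
have kE : kappa = S' 0 - (partial i w 0 - partial j w 0).
  by rewrite /kappa /quadratic_jet opprD opprK addrA.
have w'0 : w' 0 = 0 by exact: f0.
have defectE t b : tangency_defect f I i j t b = w' (two_block I t b)
    - b * ((w (two_block I t b) - w' (two_block I t b)) / t) by [].
clearbody kappa; clearbody S S'; clearbody w w'.
have csm (u : 'rV[R]_d -> R) : smooth u -> continuous u.
  by move=> su x; exact/differentiable_continuous/(su [::]).
have cp (u : 'rV[R]_d -> R) a : smooth u -> continuous (partial a u).
  by move=> su x; exact/differentiable_continuous/(su [:: a]).
have csm2 (u : 'rV[R]_d -> R) a b : smooth u -> continuous (partial a u \- partial b u).
  move=> su x; apply: continuousB.
    exact: cp.
  exact: cp.
have [r1 r10 H1] := near_ball_lt (csm _ sS') kp.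
have [r2 r20 H2] := near_ball_lt (csm2 w i j sw) kp.
have [r3 r30 H3] := near_ball_lt (csm2 S i j sS) ltr01.
(* g is the derivative of w' in the block direction. Since w' vanishes at 0, a bound on g makes the
   defect at b = 0 of order t. *)
pose g x := \sum_k block_vec I 0 k * partial k w' x.
have sg : smooth g.
  by apply: smooth_sum => k; apply: smoothZ; exact: (smooth_iter_partial [:: k] sw').
have [r4 r40 H4] := near_ball_lt (csm _ sg) ltr01.
(* M bounds D_i S - D_j S near 0. This quantity multiplies b in the derivative of the defect, and r
   M <= |kappa| / 8 keeps the product small. *)
pose M := `|(partial i S \- partial j S) 0| + 1.
have M0 : 0 < M by rewrite ltr_wpDl.
pose q := Num.min (Num.min r1 r2) (Num.min r3 r4).
have q0 : 0 < q by rewrite !lt_min r10 r20 r30.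
have [q1 q2 q3] : [/\ q <= r1, q <= r2 & q <= r3].
  by rewrite !ge_min !lexx !orbT.
pose r := Num.min (q / 3) (`|kappa| / 8 / M).
have r0 : 0 < r by rewrite lt_min !divr_gt0 ?normr_gt0.
have rq : 3 * r <= q by rewrite mulrC -ler_pdivlMr// ge_min lexx.
have rM : r * M <= `|kappa| / 8 by rewrite -ler_pdivlMr// ge_min lexx orbT.
exists r, (`|g 0| + 1); split => //.
- have small (t b : R) (y : 'rV[R]_d) :
      0 < t < r -> `|b| <= r -> `|y| <= `|two_block I t b| -> `|y| < q.
    move=> /andP[t0 tr] br yl; have := two_block_norm I t b.
    by rewrite (gtr0_norm t0) => H; move: t0 tr br yl rq H r0; lra.
  have deriv (t b : R) : 0 < t < r -> `|b| <= r -> exists2 D : R,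
      is_derive b (1 : R) (tangency_defect f I i j t) D & `|D - kappa| <= `|kappa| / 2.
    move=> tt br; have [t0 tr] := andP tt.
    have D1 := is_derive_two_block I t b dw.
    have D2 := is_derive_two_block I t b dw'.
    rewrite SdefE in D1; rewrite S'defE in D2.
    set x := two_block I t b in D1 D2.
    exists (S' x - (b * ((S x - S' x) / t) + (w x - w' x) / t)).
      have -> : tangency_defect f I i j t = (fun b => w' (two_block I t b))
          - id * (t^-1 *: ((fun b => w (two_block I t b)) - (fun b => w' (two_block I t b)))).
        by apply/funext => c; rewrite defectE !fctE /GRing.scale /= [_ / t]mulrC.
      apply: is_derive_eq; rewrite !fctE /GRing.scale /= -/x.
      by move: (S x) (S' x) (w x) (w' x) => A B C D; rewrite mulr1 ![t^-1 * _]mulrC.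
    have [y yx] := swap_mean_value x ij dw.
    have [z zx] := swap_mean_value x ij dS.
    have xij : x 0 i - x 0 j = t.
      by rewrite !two_blockE iI (negbTE jI) mulr1 mulr0 add0r addrK.
    rewrite -wE -SE xij => -> ->.
    rewrite mulrAC divff ?gt_eqF// mul1r mulrAC divff ?gt_eqF// mul1r.
    have h1 := H1 x (lt_le_trans (small _ _ _ tt br (lexx _)) q1).
    have h2 := H2 y (lt_le_trans (small _ _ _ tt br yx) q2).
    have h3 := H3 z (lt_le_trans (small _ _ _ tt br zx) q3).
    move: h1 h2 h3 rM kE; rewrite /M /=.
    move: (S' x) (S' 0) (partial i w y) (partial j w y) (partial i w 0) (partial j w 0).
    move: (partial i S z) (partial j S z) (partial i S 0) (partial j S 0).
    move=> a1 a2 a3 a4 b1 b2 b3 b4 b5 b6 h1 h2 h3 rM kE.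
    (* Three errors, each at most |kappa| / 8: the variation of S', that of D_i w - D_j w, and the
       term in b. *)
    have -> : b1 - (b * (a1 - a2) + (b3 - b4)) - kappa =
      (b1 - b2) - (b3 - b4 - (b5 - b6)) - b * (a1 - a2) by rewrite kE; ring.
    rewrite (le_trans (ler_normB _ _))// (le_trans (lerD (ler_normB _ _) (lexx _)))//.
    have h4 : `|b * (a1 - a2)| <= r * (`|a3 - a4| + 1).
      rewrite normrM ler_pM//.
      have -> : a1 - a2 = (a1 - a2 - (a3 - a4)) + (a3 - a4) by ring.
      by rewrite (le_trans (ler_normD _ _))// addrC lerD2l ltW.
    lra.
  move=> t b c tt; wlog bc : b c / c < b => [hw br cr|].
    have [cb|bc|->] := ltgtP c b; first exact: hw.
      have := hw _ _ bc cr br; rewrite (distrC c b).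
      move: (tangency_defect f I i j t b) (tangency_defect f I i j t c) => B C.
      have -> : B - C - kappa * (b - c) = - (C - B - kappa * (c - b)) by ring.
      by rewrite normrN.
    by rewrite !subrr mulr0 subrr normr0 mulr0.
  move=> br cr.
  have inI e : e \in `[c, b]%R -> `|e| <= r.
    by rewrite in_itv /= => /andP[ce eb]; move: br cr; rewrite !ler_norml; lra.
  pose h e := tangency_defect f I i j t e - kappa * e.
  have /choice[D HD] e : exists D, e \in `[c, b]%R ->
      is_derive e (1 : R) h (D - kappa) /\ `|D - kappa| <= `|kappa| / 2.
    have [eI|] := boolP (e \in `[c, b]%R); last by exists 0.
    have [D dD Dk] := deriv t e tt (inI e eI).
    exists D => _; split => //.
    have -> : h = tangency_defect f I i j t - kappa *: id by [].
    by apply: is_derive_eq; rewrite /GRing.scale /= mulr1.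
  have ch : {within `[c, b], continuous h}.
    by apply: derivable_within_continuous => e /HD[dh _]; exact: ex_derive.
  have dh e : e \in `]c, b[%R -> is_derive e (1 : R) h (D e - kappa).
    by move=> /subset_itv_oo_cc/HD[].
  have [e eI] := MVT bc dh ch.
  have -> : h b - h c = tangency_defect f I i j t b - tangency_defect f I i j t c
        - kappa * (b - c) by rewrite /h; ring.
  move=> ->; rewrite normrM ler_wpM2r//.
  by have [] := HD e (subset_itv_oo_cc eI).
- move=> t /andP[t0 tr].
  rewrite defectE mul0r subr0.
  have [th /andP[th0 th1]] := mean_value_line 0 (t *: block_vec I) dw'.
  rewrite add0r w'0 subr0.
  have -> : two_block I t 0 = t *: block_vec I by rewrite /two_block scale0r addr0.
  rewrite add0r => ->; set xi := th *: _.
  have xiq : `|xi| < r4.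
    rewrite /xi scalerA -[_ *: _]addr0 -(scale0r (const_mx 1)).
    rewrite (le_lt_trans (two_block_norm _ _ _))// normr0 addr0 gtr0_norm ?mulr_gt0//.
    have : q <= r4 by rewrite !ge_min lexx !orbT.
    have : th * t < t by rewrite gtr_pMl.
    lra.
  have -> : \sum_k (t *: block_vec I) 0 k * partial k w' xi = t * g xi.
    by rewrite mulr_sumr; apply: eq_bigr => k _; rewrite !mxE mulrA.
  rewrite normrM gtr0_norm// mulrC ler_pM2r//.
  have -> : g xi = (g xi - g 0) + g 0 by ring.
  by rewrite (le_trans (ler_normD _ _))// addrC lerD2l ltW// H4.
Qed.

End TwoBlocks.

(** * The arc attached to a proper nonempty block *)

Section Arcs.
Context {R : realType} {d : nat}.
Implicit Types (f : 'rV[R]_d -> R) (x : 'rV[R]_d) (I : {set 'I_d}).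

Lemma two_block_continuous (T : topologicalType) I (u v : T -> R) (t : T) :
  {for t, continuous u} -> {for t, continuous v} ->
  {for t, continuous (fun t => two_block I (u t) (v t))}.
Proof.
move=> cu cv.
apply: (@continuousD _ _ _ (fun t => u t *: block_vec I)
                           (fun t => v t *: const_mx 1)).
  exact: continuousZr_tmp.
exact: continuousZr_tmp.
Qed.

Lemma two_block_arc f I (beta : R -> R) (eps : R) : 0 < eps -> beta 0 = 0 ->
  {in `[0, eps[%R, continuous beta} ->
  (forall t, 0 < t < eps -> tangency_set f (two_block I t (beta t))
                            /\ two_block I t (beta t) != 0) ->
  tangency_arc f eps (fun t => two_block I t (beta t)).
Proof.
move=> e0 b0 cb H; split => //.
  apply: continuous_in_subspaceT => t; rewrite inE /= => te.
  by apply: two_block_continuous; [exact: cvg_id|exact: cb].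
by rewrite b0 /two_block !scale0r addr0.
Qed.

Lemma two_block_neq0 I (t b : R) (i j : 'I_d) : i \in I -> j \notin I -> t != 0 ->
  two_block I t b != 0.
Proof.
move=> iI jI; apply: contraNneq => H.
have : two_block I t b 0 i - two_block I t b 0 j = t.
  by rewrite !two_blockE iI (negbTE jI) mulr1 mulr0 add0r addrK.
by rewrite H !mxE subrr => <-.
Qed.

Lemma continuous_defect (u v c w : R -> R) (t : R) :
  {for t, continuous u} -> {for t, continuous v} -> {for t, continuous c} ->
  {for t, continuous w} -> w t != 0 ->
  {for t, continuous (fun t => v t - c t * ((u t - v t) / w t))}.
Proof.
move=> cu cv cc cw w0.
exact: (cvgB cv (cvgM cc (cvgM (cvgB cu cv) (cvgV w0 cw)))).
Qed.

(** The branch of zeros is the arc, and its uniqueness puts every small tangency point of this block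
    shape on it. The last two bounds make t and |x| comparable, for use in the count and in the
    isotropy argument. *)
Lemma proper_block_arc f I (i j : 'I_d) :
  smooth f -> Sd_invariant f -> (forall k, partial k f 0 = 0) ->
  i \in I -> j \notin I -> quadratic_jet f i j != 0 ->
  exists eps beta K, [/\ 0 < K,
    tangency_arc f eps (fun t => two_block I t (beta t)) &
    \forall x \near (0 : 'rV[R]_d), tangency_set f x ->
      forall t b, 0 < t -> x = two_block I t b ->
      [/\ t < eps, b = beta t, `|b| <= K * t & t <= 2 * `|x|] ].
Proof.
move=> sf fS f0 iI jI k0.
have [r [K [r0 K0 H1 H2]]] := tangency_defect_near sf fS iI jI k0 f0.
have dp k y : differentiable (partial k f) y by exact: (sf [:: k]).
have cE1 t b : 0 < t -> {for t, continuous (tangency_defect f I i j ^~ b)}.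
  move=> t0.
  have cx k : {for t, continuous (fun t => partial k f (two_block I t b))}.
    apply: (@continuous_comp _ _ _ (fun t => two_block I t b) (partial k f)).
      by apply: two_block_continuous; [exact: cvg_id|exact: cvg_cst].
    exact: differentiable_continuous.
  apply: (continuous_defect (cx i) (cx j) (c := cst b) (w := id)).
  - exact: cvg_cst.
  - exact: cvg_id.
  - by rewrite gt_eqF.
have cE2 t : 0 < t -> continuous (tangency_defect f I i j t).
  move=> t0 b.
  have cx k : {for b, continuous (fun b => partial k f (two_block I t b))}.
    apply: (@continuous_comp _ _ _ (fun b => two_block I t b) (partial k f)).
      by apply: two_block_continuous; [exact: cvg_cst|exact: cvg_id].
    exact: differentiable_continuous.
  apply: (continuous_defect (cx i) (cx j) (c := id) (w := cst t)).
  - exact: cvg_id.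
  - exact: cvg_cst.
  - by rewrite /= gt_eqF.
have [eps [beta [/andP[e0 er] cb Hb E0 uniq]]] :=
  implicit_branch k0 r0 K0 H1 H2 cE1 cE2.
have kp : 0 < `|quadratic_jet f i j| by rewrite normr_gt0.
exists eps, beta, (2 * K / `|quadratic_jet f i j|); split.
- by rewrite divr_gt0// mulr_gt0.
- apply: two_block_arc => //.
    apply/eqP; rewrite -normr_le0; have := Hb 0.
    by rewrite normr0 mulr0; apply.
  move=> t tt; have /andP[t0 te] := tt.
  split; last by rewrite (two_block_neq0 _ iI jI)// gt_eqF.
  by apply/(tangency_defectP _ fS iI jI); [rewrite gt_eqF|exact: E0].
(* t is a difference of two coordinates of x, so t <= 2 |x|, and |x| < eps / 2 forces t < eps. *)
apply/near_norm_lt; exists (Num.min r (eps / 2)).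
  by rewrite lt_min r0 divr_gt0.
move=> x; rewrite lt_min => /andP[xr xe] xf t b t0 xE.
have xi := norm_coord x i; have xj := norm_coord x j.
have xi' : x 0 i = t + b by rewrite xE two_blockE iI mulr1.
have xj' : x 0 j = b by rewrite xE two_blockE (negbTE jI) mulr0 add0r.
rewrite xi' in xi; rewrite xj' in xj.
have t2 : t <= 2 * `|x| by move: xi xj; rewrite !ler_norml; lra.
have te : t < eps by lra.
have bE : b = beta t.
  apply: uniq; [by rewrite t0|by rewrite (le_trans xj)// ltW|].
  by apply/(tangency_defectP _ fS iI jI); [rewrite gt_eqF|rewrite -xE].
split => //; rewrite bE -[X in _ * X](gtr0_norm t0); apply: Hb.
by rewrite gtr0_norm.
Qed.

End Arcs.

(** * All tangency points near 0 lie on finitely many arcs *)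

Section LocalStructure.
Context {R : realType} {d : nat}.
Implicit Types (f : 'rV[R]_d -> R) (x : 'rV[R]_d) (I : {set 'I_d}).

Definition jet_generic f : Prop :=
  (forall i j, i != j -> quadratic_jet f i j != 0) /\
  (forall i j k, i != j -> i != k -> j != k -> cubic_jet f i j k != 0).

Lemma diagonal_tangency f I (t b : R) : Sd_invariant f ->
  (forall k l : 'I_d, (k \in I) = (l \in I)) ->
  tangency_set f (two_block I t b).
Proof.
move=> fS HI k l; rewrite (partial_two_block t b fS (HI k l)).
by rewrite !two_blockE (HI k l).
Qed.

(* The arcs along the diagonal are those of [setT] and [set0]; the bottom value
   b is then normalized to 0 and -t respectively. *)
Definition normalized_block I (t b : R) : Prop :=
  [/\ 0 < t, I = [set: 'I_d]%SET -> b = 0 & I = finset.set0 -> b = - t].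

Lemma diagonal_arc f I (c : R) (i0 : 'I_d) : Sd_invariant f ->
  (forall k l : 'I_d, (k \in I) = (l \in I)) -> `|(i0 \in I)%:R + c| = 1 ->
  tangency_arc f 1 (fun t => two_block I t (c * t)).
Proof.
move=> fS HI c1; apply: two_block_arc => //.
- by rewrite mulr0.
- by move=> t _; apply: continuousM; [exact: cvg_cst|exact: cvg_id].
move=> t /andP[t0 _]; split; first exact: diagonal_tangency.
apply: contra_eq_neq c1 => /rowP/(_ i0); rewrite two_blockE mxE.
rewrite mulrC -mulrDl => /eqP; rewrite mulf_eq0 (gt_eqF t0) orbF => /eqP ->.
by rewrite normr0 eq_sym oner_eq0.
Qed.

(** On a full or empty block every pair (t, b) gives a diagonal, hence tangent, point; the
    normalization b = c t with c = 0 or c = -1 selects a half-line. The other blocks come from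
    [proper_block_arc]. *)
Lemma block_arc f I (i0 : 'I_d) :
  smooth f -> Sd_invariant f -> (forall k, partial k f 0 = 0) ->
  (forall i j, i != j -> quadratic_jet f i j != 0) ->
  exists eps gamma K, [/\ 0 < K, tangency_arc f eps gamma &
    \forall x \near (0 : 'rV[R]_d), tangency_set f x ->
      forall t b, normalized_block I t b -> x = two_block I t b ->
      [/\ t < eps, gamma t = x, `|x| <= K * t & t <= 2 * `|x|] ].
Proof.
move=> sf fS f0 q0.
have diag (c : R) : (forall k l : 'I_d, (k \in I) = (l \in I)) ->
    `|(i0 \in I)%:R + c| = 1 ->
    (forall t b, normalized_block I t b -> b = c * t) ->
    exists eps gamma K, [/\ 0 < K, tangency_arc f eps gamma &
    \forall x \near (0 : 'rV[R]_d), tangency_set f x ->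
      forall t b, normalized_block I t b -> x = two_block I t b ->
      [/\ t < eps, gamma t = x, `|x| <= K * t & t <= 2 * `|x|] ].
  move=> HI c1 Hc; exists 1, (fun t => two_block I t (c * t)), (1 + `|c|); split.
  - by rewrite ltr_pwDl.
  - exact: diagonal_arc c1.
  apply/near_norm_lt; exists 1 => // x x1 _ t b /[dup] -[t0 _ _] /Hc -> xE.
  have tx : t <= `|x|.
    have := norm_coord x i0; rewrite xE two_blockE mulrC -mulrDl normrM c1 mul1r.
    by rewrite gtr0_norm.
  split=> //; first exact: le_lt_trans x1.
    rewrite xE (le_trans (two_block_norm _ _ _))// normrM (gtr0_norm t0).
    by rewrite mulrDl mul1r.
  by rewrite (le_trans tx)// ler_peMl// ler1n.
have [IT|nT] := eqVneq I [set: 'I_d]%SET.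
  apply: (diag 0) => [k l||t b [_ /(_ IT) -> _]].
  - by rewrite IT !finset.inE.
  - by rewrite IT finset.inE addr0 normr1.
  - by rewrite mul0r.
have [I0|n0] := eqVneq I finset.set0.
  apply: (diag (- 1)) => [k l||t b [_ _ /(_ I0) ->]].
  - by rewrite I0 !finset.inE.
  - by rewrite I0 finset.inE add0r normrN normr1.
  - by rewrite mulN1r.
have [i iI] := set0Pn _ n0.
have /subsetPn[j _ jI] : ~~ ([set: 'I_d]%SET \subset I) by rewrite finset.subTset.
have ij : i != j by apply: contraNneq jI => <-.
have [eps [beta [K [K0 ta Hx]]]] := proper_block_arc sf fS f0 iI jI (q0 i j ij).
exists eps, (fun t => two_block I t (beta t)), (1 + K); split => //.
  by rewrite addr_gt0.
apply: filterS Hx => x Hx xf t b [t0 _ _] xE.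
have [te bE bK t2] := Hx xf t b t0 xE.
split => //; first by rewrite -bE.
rewrite xE (le_trans (two_block_norm _ _ _))// (gtr0_norm t0) mulrDl mul1r.
by rewrite lerD2l.
Qed.

Lemma tangency_two_values f (i0 : 'I_d) : smooth f -> Sd_invariant f ->
  (forall i j k, i != j -> i != k -> j != k -> cubic_jet f i j k != 0) ->
  \forall x \near (0 : 'rV[R]_d), tangency_set f x -> x != 0 ->
    exists I t b, normalized_block I t b /\ x = two_block I t b.
Proof.
move=> sf fS c0.
have H (i j k : 'I_d) : \forall x \near (0 : 'rV[R]_d),
    i != j -> i != k -> j != k -> tangency_set f x ->
    [|| x 0 i == x 0 j, x 0 i == x 0 k | x 0 j == x 0 k].
  have [ij|] := boolP (i != j); last by move=> _; near=> x.
  have [ik|] := boolP (i != k); last by move=> _; near=> x.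
  have [jk|] := boolP (j != k); last by move=> _; near=> x.
  have H := tangency_three_values sf fS ij ik jk (c0 i j k ij ik jk).
  by near=> x => _ _ _; near: x; exact: H.
have : \forall x \near (0 : 'rV[R]_d), forall i j k : 'I_d,
    i != j -> i != k -> j != k -> tangency_set f x ->
    [|| x 0 i == x 0 j, x 0 i == x 0 k | x 0 j == x 0 k].
  exact: (@filter_forall _ _ _ _ _ (fun i => @filter_forall _ _ _ _ _ (fun j =>
    @filter_forall _ _ _ _ _ (H i j)))).
apply: filterS => x Hx xf x0.
have [[i [j xij]]|alleq] := pselect (exists i j, x 0 j < x 0 i).
  (* I collects the coordinates with the larger value x_i; [Hx] forces all the others to equal
     x_j. *)
  pose I := [set k | x 0 k == x 0 i]%SET.
  have iI : i \in I by rewrite finset.inE.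
  have jI : j \notin I by rewrite finset.inE lt_eqF.
  exists I, (x 0 i - x 0 j), (x 0 j); split.
    split; first by rewrite subr_gt0.
      by move=> IT; rewrite IT finset.inE in jI.
    by move=> I0; rewrite I0 finset.inE in iI.
  apply/rowP => k; rewrite two_blockE finset.inE.
  have [->|nki] := eqVneq (x 0 k) (x 0 i); first by rewrite mulr1 subrK.
  rewrite mulr0 add0r.
  have ki : k != i by apply: contraNneq nki => ->.
  have [-> //|kj] := eqVneq k j.
  have ji : j != i by apply: contraTneq xij => ->; rewrite ltxx.
  have := Hx k j i kj ki ji xf.
  by rewrite (negbTE nki) (lt_eqF xij) !orbF => /eqP.
have xc k l : x 0 k = x 0 l.
  by apply/eqP; rewrite eq_le !leNgt; apply/andP; split; apply/negP => lt_kl;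
    apply: alleq; [exists k, l|exists l, k].
(* On the diagonal, the sign of the common value chooses between the full and the empty block. *)
have [c0'|c0'|xi0] := ltgtP 0 (x 0 i0).
- exists [set: 'I_d]%SET, (x 0 i0), 0; split.
    by split => // /setP/(_ i0); rewrite !finset.inE.
  by apply/rowP => k; rewrite two_blockE finset.inE mulr1 addr0.
- exists finset.set0, (- x 0 i0), (x 0 i0); split.
    split; [by rewrite oppr_gt0| |by rewrite opprK].
    by move=> /setP/(_ i0); rewrite !finset.inE.
  by apply/rowP => k; rewrite two_blockE finset.inE mulr0 add0r.
exfalso; move/eqP: x0; apply; apply/rowP => k.
by rewrite mxE (xc k i0) -xi0.
Unshelve. all: by end_near. Qed.

Lemma local_structure f (i0 : 'I_d) :
  smooth f -> Sd_invariant f -> (forall k, partial k f 0 = 0) -> jet_generic f ->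
  exists (eps : {set 'I_d} -> R) (gamma : {set 'I_d} -> R -> 'rV[R]_d) (K : R),
  [/\ 0 < K, forall I, tangency_arc f (eps I) (gamma I) &
    \forall x \near (0 : 'rV[R]_d), tangency_set f x -> x != 0 ->
      exists I t b, [/\ 0 < t < eps I, x = two_block I t b, gamma I t = x,
                        `|x| <= K * t & t <= 2 * `|x|] ].
Proof.
move=> sf fS f0 [q0 c0].
have H I := block_arc I i0 sf fS f0 q0.
have [eps /choice[gamma /choice[K HK]]] := choice H.
(* A sum of positive constants dominates each of them, giving one K for all blocks. *)
exists eps, gamma, (\sum_I K I); split.
- rewrite (bigD1 finset.set0)//= ltr_pwDl//; first by have [] := HK finset.set0.
  by apply: sumr_ge0 => I _; have [/ltW] := HK I.
- by move=> I; have [] := HK I.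
have Hn I : \forall x \near (0 : 'rV[R]_d), tangency_set f x ->
      forall t b, normalized_block I t b -> x = two_block I t b ->
      [/\ t < eps I, gamma I t = x, `|x| <= K I * t & t <= 2 * `|x|].
  by have [] := HK I.
have : \forall x \near (0 : 'rV[R]_d), forall I, tangency_set f x ->
      forall t b, normalized_block I t b -> x = two_block I t b ->
      [/\ t < eps I, gamma I t = x, `|x| <= K I * t & t <= 2 * `|x|].
  exact: (@filter_forall _ _ _ _ _ Hn).
apply: filterS2 (tangency_two_values i0 sf fS c0) => x Hx Hy xf x0.
have [I [t [b [nb xE]]]] := Hx xf x0.
have [t0 _ _] := nb.
have [te gE xK t2] := Hy I xf t b nb xE.
exists I, t, b; split => //; first by rewrite t0.
rewrite (le_trans xK)// ler_pM2r// (bigD1 I)//= lerDl.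
by apply: sumr_ge0 => J _; have [/ltW] := HK J.
Qed.

End LocalStructure.

(** * Isotropy groups of tangency arcs *)

Section Isotropy.
Context {R : realType} {d : nat}.
Implicit Types (f : 'rV[R]_d -> R) (x : 'rV[R]_d) (I : {set 'I_d}).

Definition set_stab I : {set 'S_d} :=
  [set g : 'S_d | [forall k, (g k \in I) == (k \in I)]]%SET.

Lemma isotropy_level x (g : 'S_d) :
  (g \in isotropy x) = [forall k, x 0 (g k) == x 0 k].
Proof.
rewrite finset.inE; apply/eqP/forallP => [/rowP H k|H].
  by have := H k; rewrite mxE => ->.
by apply/rowP => k; rewrite mxE (eqP (H k)).
Qed.

Lemma isotropy_two_block I (t b : R) : t != 0 ->
  isotropy (two_block I t b) = set_stab I.
Proof.
move=> t0; apply/setP => g; rewrite isotropy_level finset.inE.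
apply: eq_forallb => k; rewrite !two_blockE (inj_eq (addIr _)).
rewrite (inj_eq (mulfI t0)) eqr_nat.
by case: (g k \in I); case: (k \in I).
Qed.

Lemma set_stabC I : set_stab (~: I) = set_stab I.
Proof.
apply/setP => g; rewrite !finset.inE; apply: eq_forallb => k.
by rewrite !finset.inE (inj_eq negb_inj).
Qed.

(** Listing the elements of I before those of its complement defines s. *)
Lemma perm_onto_set I : exists s : 'S_d, forall i, (s i \in I) = (i < #|I|)%N.
Proof.
case: d I => [|n] I; first by exists 1%g; case.
pose e := enum I ++ enum (~: I).
have ue : uniq e.
  rewrite cat_uniq !enum_uniq andbT /=; apply/hasPn => i.
  by rewrite !mem_enum finset.inE.
have se : size e = n.+1.
  by rewrite size_cat -!cardE cardsC card_ord.
pose h (i : 'I_n.+1) := nth ord0 e i.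
have hinj : injective h.
  by move=> i j /eqP; rewrite nth_uniq ?se// => /eqP/val_inj.
exists (perm hinj) => i; rewrite permE /h nth_cat -cardE.
case: ltnP => iI.
  by rewrite -(mem_enum I) mem_nth// -cardE.
have : nth ord0 (enum (~: I)) (i - #|I|) \in enum (~: I).
  by rewrite mem_nth// -cardE ltn_subLR// cardsC card_ord.
by rewrite mem_enum finset.inE => /negbTE.
Qed.

Lemma set_stab_young I : exists (q : nat) (s : 'S_d),
  (q <= d./2)%N /\ set_stab I = (young d q :^ s)%g.
Proof.
(* I and its complement have the same stabilizer, so I may be taken as the larger block; then q = d
   - |I| is at most d / 2. *)
wlog HI : I / (d <= 2 * #|I|)%N.
  move=> H; case: (leqP d (2 * #|I|)) => [|HI]; first exact: H.
  rewrite -set_stabC; apply: H.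
  by have := cardsC I; rewrite card_ord; lia.
have Id : (#|I| <= d)%N by rewrite -[X in (_ <= X)%N]card_ord max_card.
have [s Hs] := perm_onto_set I.
exists (d - #|I|)%N, s; split.
  by rewrite -divn2 leq_divRL//; lia.
apply/setP => g; rewrite mem_conjg !finset.inE subKn//.
have E k : ((g ^ s^-1)%g k < #|I|)%N = (g (s k) \in I).
  by rewrite -Hs conjgE invgK !permM permKV.
apply/forallP/forallP => H k; first by rewrite E -Hs; exact: H.
by have := H (s^-1%g k); rewrite E -Hs permKV.
Qed.

(* A coordinate difference is 0 or at least |x| / K at the small tangency
   points x, so by the intermediate value theorem it cannot start or stop
   vanishing along an arc. *)
Lemma arc_equal_coord f (eps tau K : R) (gamma : R -> 'rV[R]_d) (i j : 'I_d) :
  tangency_arc f eps gamma -> 0 < K -> tau <= eps ->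
  (forall t, 0 < t < tau -> gamma t 0 i != gamma t 0 j ->
     `|gamma t| <= K * `|gamma t 0 i - gamma t 0 j|) ->
  forall t1 t2, 0 < t1 < tau -> 0 < t2 < tau ->
  gamma t1 0 i = gamma t1 0 j -> gamma t2 0 i = gamma t2 0 j.
Proof.
move=> [e0 cg g0 tg] K0 te H t1 t2 tt1 tt2 E1.
apply/eqP; apply: contraPT isT => E2.
have g_gt0 t : 0 < t < tau -> 0 < `|gamma t|.
  by move=> /andP[t0 tt]; rewrite normr_gt0; apply: (tg t _).2; rewrite t0 (lt_le_trans tt te).
(* phi is negative where the two coordinates agree and at least |gamma(t)| > 0 where they differ, so
   it has no zero and cannot change sign. *)
pose phi (t : R) := 2 * K * `|gamma t 0 i - gamma t 0 j| - `|gamma t|.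
have phi1 : phi t1 < 0.
  by rewrite /phi E1 subrr normr0 mulr0 sub0r oppr_lt0 g_gt0.
have phi2 : 0 < phi t2.
  have := H t2 tt2 E2; have := g_gt0 t2 tt2; rewrite /phi -mulrA; lra.
have cphi a b : 0 < a -> b < tau -> {within `[a, b], continuous phi}.
  move=> a0 bt.
  have : {within `[a, b], continuous gamma}.
    apply: continuous_subspaceW cg => t /=; rewrite !in_itv /= => /andP[at_ tb].
    by rewrite (le_trans (ltW a0) at_) (le_lt_trans tb (lt_le_trans bt te)).
  move=> cab t.
  apply: (@continuous_comp _ _ _ (gamma : subspace `[a, b] -> _)
    (fun x : 'rV[R]_d => 2 * K * `|x 0 i - x 0 j| - `|x|)); first exact: cab.
  have cc k : (fun x : 'rV[R]_d => x 0 k) x @[x --> gamma t] --> gamma t 0 k.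
    exact: coord_continuous.
  exact: (cvgB (cvgM (cvg_cst _) (cvg_norm (cvgB (cc i) (cc j)))) (cvg_norm cvg_id)).
have root : exists2 c, 0 < c < tau & phi c = 0.
  have [/andP[a0 at_] /andP[b0 bt]] := (tt1, tt2).
  have [t12|t21] := leP t1 t2.
    have [|c] := IVT t12 (cphi _ _ a0 bt) (v := 0).
      by rewrite min_l ?max_r; lra.
    rewrite in_itv /= => /andP[c1 c2] pc; exists c => //.
    by rewrite (lt_le_trans a0 c1) (le_lt_trans c2 bt).
  have [|c] := IVT (ltW t21) (cphi _ _ b0 at_) (v := 0).
    by rewrite min_r ?max_l; lra.
  rewrite in_itv /= => /andP[c1 c2] pc; exists c => //.
  by rewrite (lt_le_trans b0 c1) (le_lt_trans c2 at_).
have [c ct pc] := root.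
have gc := g_gt0 c ct.
have [Ec|Ec] := eqVneq (gamma c 0 i) (gamma c 0 j).
  by move: pc; rewrite /phi Ec subrr normr0 mulr0 => ?; lra.
by have := H c ct Ec; move: pc; rewrite /phi -mulrA => ? ?; lra.
Qed.

(** The arc is arbitrary, not one of those constructed. Near 0 it runs through two-block points,
    where two coordinates agree or differ by exactly s, with |x| <= K s; this is the gap that
    [arc_equal_coord] requires. *)
Lemma arc_isotropy_young f (i0 : 'I_d) (eps : R) (gamma : R -> 'rV[R]_d) :
  smooth f -> Sd_invariant f -> (forall k, partial k f 0 = 0) -> jet_generic f ->
  tangency_arc f eps gamma ->
  exists (q : nat) (s : 'S_d),
    (q <= d./2)%N /\ arc_isotropy gamma (young d q :^ s)%g.
Proof.
move=> sf fS f0 gf /[dup] ta [e0 cg g0 tg].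
have [eps' [gamma' [K [K0 _ /near_norm_lt[r r0 Hr]]]]] := local_structure i0 sf fS f0 gf.
have [tau [tau0 te Ht]] : exists tau, [/\ 0 < tau, tau <= eps &
    forall t, 0 < t < tau -> `|gamma t| < r].
  have Z0 : `[0, eps[%classic (0 : R) by rewrite /= in_itv /= lexx.
  have : gamma @ within `[0, eps[ (nbhs (0 : R)) --> gamma 0.
    by rewrite (nbhs_subspace_in Z0); exact: cg.
  move=> /cvgrPdist_lt /(_ r r0); rewrite near_withinE => /(@nbhs_norm0P _ R)[e /= ep He].
  exists (Num.min e eps); split; rewrite ?lt_min ?ep ?ge_min ?lexx ?orbT//.
  move=> t; rewrite lt_min => /and3P[t0 te tE].
  have := He t; rewrite /= gtr0_norm// => /(_ te).
  by rewrite in_itv /= (ltW t0) tE g0 sub0r normrN; apply.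
have Hg t : 0 < t < tau -> exists I s b,
    [/\ 0 < s, gamma t = two_block I s b & `|gamma t| <= K * s].
  move=> /[dup] tt /andP[t0 tt'].
  have [tgt gt0] := tg t (introT andP (conj t0 (lt_le_trans tt' te))).
  have [I [s [b [/andP[s0 _] E _ ? _]]]] := Hr _ (Ht t tt) tgt gt0.
  by exists I, s, b.
have Hij i j t : 0 < t < tau -> gamma t 0 i != gamma t 0 j ->
    `|gamma t| <= K * `|gamma t 0 i - gamma t 0 j|.
  move=> /Hg[I [s [b [s0 -> le]]]]; rewrite !two_blockE => ne.
  rewrite opprD addrACA subrr addr0 -mulrBr normrM (gtr0_norm s0).
  suff -> : `|(i \in I)%:R - (j \in I)%:R| = 1 :> R by rewrite mulr1.
  by move: ne; case: (i \in I); case: (j \in I);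
    rewrite ?eqxx// ?subr0 ?sub0r ?normrN normr1.
(* Coincidences of coordinates do not change on ]0, tau[, so the group read at tau / 2 is that of
   all small times. *)
have th : 0 < tau / 2 < tau by rewrite divr_gt0//=; lra.
have [I [s [b [s0 E _]]]] := Hg _ th.
have [q [u [qd Eq]]] := set_stab_young I.
exists q, u; split => //; rewrite -Eq -(isotropy_two_block I b (lt0r_neq0 s0)) -E.
near=> t.
have tt : 0 < t < tau.
  by apply/andP; split; near: t; [exact: nbhs_right_gt|exact: nbhs_right_lt].
apply/setP => g; rewrite !isotropy_level; apply: eq_forallb => k.
by apply/eqP/eqP; apply: (arc_equal_coord ta K0 te (Hij _ _)).
Unshelve. all: by end_near. Qed.

End Isotropy.

(** * Counting the arcs by subsets of the coordinates *)

Section CountingArcs.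
Context {R : realType} {d : nat}.
Implicit Types (f : 'rV[R]_d -> R) (x : 'rV[R]_d) (I : {set 'I_d}).

Lemma card_set_type : #|{: {set 'I_d}}| = (2 ^ d)%N.
Proof.
by rewrite -cardsT -powersetT card_powerset cardsT card_ord.
Qed.

Lemma generic_tangency_arcs f (i0 : 'I_d) :
  smooth f -> Sd_invariant f -> (forall k, partial k f 0 = 0) -> jet_generic f ->
  exists (N : nat) (eps : 'I_N -> R) (gamma : 'I_N -> R -> 'rV[R]_d),
    [/\ N%:R <= 2 ^+ d :> R, forall k, tangency_arc f (eps k) (gamma k)
      & germ_consists_of_arcs (tangency_set f) eps gamma].
Proof.
move=> sf fS f0 gf.
have [eps [gamma [K [K0 ta Hx]]]] := local_structure i0 sf fS f0 gf.
exists #|{: {set 'I_d}}|, (fun k => eps (enum_val k)), (fun k => gamma (enum_val k)).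
split; first by rewrite card_set_type natrX.
  by move=> k; exact: ta.
move=> rho rho0.
have /near_norm_lt[r r0 Hr] := Hx.
(* The radius rho / 2 ensures t <= 2 |x| < rho. *)
apply/near_norm_lt; exists (Num.min r (rho / 2)).
  by rewrite lt_min r0 divr_gt0.
move=> x; rewrite lt_min => /andP[xr xrho]; split=> [xf|[k [t [t0 te _ <-]]]].
  have [x0|x0] := eqVneq x 0.
    (* The origin is the point t = 0 of any arc; that of the empty block serves. *)
    exists (enum_rank finset.set0), 0; rewrite enum_rankK.
    by have [e0 _ g0 _] := ta finset.set0; split; rewrite ?x0.
  have [I [t [b [/andP[t0 te] _ gx _ t2]]]] := Hr x xr xf x0.
  exists (enum_rank I), t; rewrite enum_rankK; split => //; first exact: ltW.
  lra.
have [e0 _ g0 tg] := ta (enum_val k).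
move: t0; rewrite le_eqVlt => /orP[/eqP <-|t0].
  by rewrite g0 => i j; rewrite !mxE !mulr0.
by have [] := tg t; rewrite ?t0.
Qed.

End CountingArcs.

(** * Flat functions on the line *)

Section FlatFunctions.
Context {R : realType}.

(** The powers of 1 / u close the family under differentiation, which takes index k to k + 1 and k +
    2. *)
Definition flat (k : nat) (u : R) : R :=
  if 0 < u then u^-1 ^+ k * expR (- u^-1) else 0.

Lemma flat_le0 k u : u <= 0 -> flat k u = 0.
Proof. by rewrite /flat leNgt => /negbTE ->. Qed.

Lemma flat_gt0 k u : 0 < u -> 0 < flat k u.
Proof. by move=> u0; rewrite /flat u0 mulr_gt0 ?exprn_gt0 ?invr_gt0 ?expR_gt0. Qed.

Lemma flat_ge0 k u : 0 <= flat k u.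
Proof. by case: (leP u 0) => [/flat_le0 -> //|/(flat_gt0 k)/ltW]. Qed.

(** At y = 1 / u the exponential exceeds y^(k+2) / (k+2)!. Quadratic decay makes the difference
    quotient at 0 tend to 0 in [is_derive_flat]. *)
Lemma flat_quadratic k u : flat k u <= k.+2`!%:R * u ^+ 2.
Proof.
case: (leP u 0) => [u0|u0].
  by rewrite flat_le0// mulr_ge0// sqr_ge0.
rewrite /flat u0 expRN ler_pdivrMr ?expR_gt0//.
have y0 : 0 < u^-1 by rewrite invr_gt0.
have F0 : 0 < k.+2`!%:R :> R by rewrite ltr0n fact_gt0.
have H : u^-1 ^+ k.+2 / k.+2`!%:R <= expR u^-1.
  by have := @expR_ge1Dxn R u^-1 k.+1 (ltW y0); lra.
apply: (@le_trans _ _ (k.+2`!%:R * u ^+ 2 * (u^-1 ^+ k.+2 / k.+2`!%:R))).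
  rewrite le_eqVlt; apply/orP; left; apply/eqP.
  rewrite -addn2 exprD; field.
  by rewrite !gt_eqF.
by rewrite ler_wpM2l// mulr_ge0 ?sqr_ge0// ltW.
Qed.

Lemma is_derive_chain (V : normedModType R) (h : R -> R) (w : V -> R) (x v : V)
    (a : R) : is_derive (w x) 1 h a -> differentiable w x ->
  is_derive x v (h \o w) (a * 'D_v w x).
Proof.
move=> dh dw.
have fh : differentiable h (w x) by apply/derivable1_diffP; exact: ex_derive.
apply: DeriveDef; first exact/diff_derivable/differentiable_comp.
rewrite deriveE; last exact: differentiable_comp.
rewrite diff_comp//= diff1E//= derive1E derive_val deriveE//.
by rewrite /GRing.scale /= mulrC.
Qed.

Lemma is_derive_flat k (u : R) :
  is_derive u 1 (flat k) (- k%:R * flat k.+1 u + flat k.+2 u).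
Proof.
case: (ltrgtP u 0) => [u0|u0|->].
- rewrite !flat_le0 ?ltW// mulr0 addr0.
  apply: (near_eq_is_derive (f := cst 0)).
  by near=> y; rewrite flat_le0// ltW//; near: y; exact: lt_nbhsl.
- apply: (near_eq_is_derive (f := (fun y => y^-1) ^+ k * (expR \o (fun y : R => - y^-1)))).
    near=> y; rewrite /flat ifT ?fctE//.
    by near: y; exact: lt_nbhsr.
  have D1 : is_derive u 1 (fun y : R => y^-1) (- u ^- 2).
    have := @is_deriveV R id u 1 1 (lt0r_neq0 u0) (is_derive_id _ _).
    by rewrite /GRing.scale /= mulr1.
  have D2 : is_derive u 1 (expR \o (fun y : R => - y^-1)) (u ^- 2 * expR (- u^-1)).
    have D3 : is_derive u 1 (fun y : R => - y^-1) (u ^- 2).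
      by apply: is_derive_eq; rewrite opprK.
    have D4 : differentiable (fun y : R => - y^-1) u.
      by apply/derivable1_diffP; exact: ex_derive.
    have := @is_derive_chain R expR (fun y => - y^-1) u 1 _ (is_derive_expR _) D4.
    by rewrite derive_val mulrC.
  apply: is_derive_eq.
  rewrite /flat u0 /GRing.scale /= !fctE /=.
  case: k => [|k]; first by rewrite !expr0 expr1; field; rewrite gt_eqF.
  rewrite /= !exprS; field; rewrite ?gt_eqF//.
rewrite !flat_le0// mulr0 addr0.
have C0 : 0 < k.+2`!%:R :> R by rewrite ltr0n fact_gt0.
have lim0 : (fun h : R => h^-1 *: ((flat k \o shift 0) (h *: 1) - flat k 0))
    @ 0^' --> (0 : R).
  apply/cvgrPdist_lt => e e0.
  have : \forall h \near 0^', `|h : R| < e / k.+2`!%:R.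
    by apply: (@dnbhs0_lt _ R); rewrite divr_gt0.
  apply: filterS => h he.
  rewrite /= addr0 [h *: 1]mulr1 (flat_le0 k (lexx _)) subr0 sub0r normrN.
  rewrite /GRing.scale /= normrM (ger0_norm (flat_ge0 _ _)) normfV.
  have [->|h0] := eqVneq h 0; first by rewrite normr0 invr0 mul0r.
  rewrite mulrC ltr_pdivrMr ?normr_gt0//.
  rewrite (le_lt_trans (flat_quadratic _ _))// -real_normK ?num_real// expr2 mulrA.
  by rewrite ltr_pM2r ?normr_gt0// mulrC -ltr_pdivlMr.
apply: DeriveDef; first by apply/cvg_ex; exists 0.
exact/cvg_lim.
Unshelve. all: by end_near. Qed.

End FlatFunctions.

(** * An invariant function supported in the unit ball with prescribed 3-jet *)

Section Bump.
Context {R : realType} {d : nat}.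
Implicit Types (w : 'rV[R]_d -> R) (x : 'rV[R]_d).

(* A class of functions closed under the partial derivatives: this is what
   makes its members smooth. *)
Inductive elementary : ('rV[R]_d -> R) -> Prop :=
| elementary_cst c : elementary (cst c)
| elementary_coord i : elementary (fun x => x 0 i)
| elementaryD w1 w2 : elementary w1 -> elementary w2 -> elementary (w1 + w2)
| elementaryM w1 w2 : elementary w1 -> elementary w2 -> elementary (w1 * w2)
| elementary_flat k w : elementary w -> elementary (flat k \o w)
| elementaryV w : (forall x, w x != 0) -> elementary w ->
    elementary (fun x => (w x)^-1).

Lemma is_derive_coord (i j : 'I_d) x :
  is_derive x (delta_mx 0 i) (fun x : 'rV[R]_d => x 0 j) (j == i)%:R.
Proof.
apply: DeriveDef; first exact/diff_derivable/differentiable_coord.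
apply: cvg_lim => //; apply: cvg_near_cst.
have : \forall h \near 0^', h != 0 :> R by exact: nbhs_dnbhs_neq.
apply: filterS => h h0.
by rewrite /= !mxE /= addrK /GRing.scale /= mulKf.
Qed.

Lemma elementary_differentiable w : elementary w -> forall x, differentiable w x.
Proof.
elim=> {w} [c|i|w1 w2 _ IH1 _ IH2|w1 w2 _ IH1 _ IH2|k w _ IH|w w0 _ IH] x.
- exact: differentiable_cst.
- exact: differentiable_coord.
- exact: differentiableD.
- exact: differentiableM.
- apply: differentiable_comp; first exact: IH.
  by apply/derivable1_diffP; have [] := is_derive_flat k (w x).
- exact: differentiableV.
Qed.

Lemma elementary_partial w i : elementary w -> elementary (partial i w).
Proof.
elim=> {w} [c|j|w1 w2 e1 IH1 e2 IH2|w1 w2 e1 IH1 e2 IH2|k w e IH|w w0 e IH].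
- have -> : partial i (cst c) = cst 0 by apply/funext => x; exact: derive_cst.
  exact: elementary_cst.
- have -> : partial i (fun x => x 0 j) = cst (j == i)%:R.
    by apply/funext => x; have [_] := is_derive_coord i j x.
  exact: elementary_cst.
- have -> : partial i (w1 + w2) = partial i w1 + partial i w2.
    apply/funext => x; apply: deriveD; apply: diff_derivable;
      exact: elementary_differentiable.
  exact: elementaryD.
- have -> : partial i (w1 * w2) = w1 * partial i w2 + w2 * partial i w1.
    apply/funext => x; apply: deriveM; apply: diff_derivable;
      exact: elementary_differentiable.
  by apply: elementaryD; exact: elementaryM.
- have -> : partial i (flat k \o w) =
      (cst (- k%:R) * (flat k.+1 \o w) + (flat k.+2 \o w)) * partial i w.
    apply/funext => x.
    have := is_derive_chain (delta_mx 0 i) (is_derive_flat k (w x))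
      (elementary_differentiable e x).
    by move=> /@derive_val.
  apply: elementaryM => //; apply: elementaryD; last exact: elementary_flat.
  by apply: elementaryM; [exact: elementary_cst|exact: elementary_flat].
- have -> : partial i (fun x => (w x)^-1) =
      cst (-1) * (fun x => (w x)^-1) * (fun x => (w x)^-1) * partial i w.
    apply/funext => x; rewrite /partial deriveV//; last first.
      exact/diff_derivable/elementary_differentiable.
    by rewrite !fctE /GRing.scale /= expr2 invfM mulN1r !mulNr.
  by do 3?apply: elementaryM => //; [exact: elementary_cst|exact: elementaryV|exact: elementaryV].
Qed.

Lemma elementary_smooth w : elementary w -> smooth w.
Proof.
move=> ew s.
suff : elementary (iter_partial s w) by exact: elementary_differentiable.
by elim: s => [|i s IH] //=; exact: elementary_partial.
Qed.

Lemma elementary_sum (F : 'I_d -> 'rV[R]_d -> R) :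
  (forall i, elementary (F i)) -> elementary (fun x => \sum_i F i x).
Proof.
move=> eF; have -> : (fun x => \sum_i F i x) = \sum_i F i.
  by apply/funext => x; rewrite fct_sumE.
by elim/big_ind: _ => // [|w1 w2]; [exact: elementary_cst|exact: elementaryD].
Qed.

Definition power_sum (n : nat) x : R := \sum_i x 0 i ^+ n.

Lemma elementary_power_sum n : elementary (power_sum n).
Proof.
apply: elementary_sum => i; elim: n => [|n IH].
  by have -> : (fun x => x 0 i ^+ 0) = cst 1; [exact/funext|exact: elementary_cst].
have -> : (fun x => x 0 i ^+ n.+1) = (fun x => x 0 i) * (fun x => x 0 i ^+ n).
  by apply/funext => x; rewrite exprS.
by apply: elementaryM => //; exact: elementary_coord.
Qed.

Lemma power_sum_col_perm n g x : power_sum n (col_perm g x) = power_sum n x.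
Proof.
rewrite /power_sum [RHS](reindex_inj (@perm_inj _ g)).
by apply: eq_bigr => i _; rewrite mxE.
Qed.

(** It equals 1 where p_2 <= 1/2 and 0 where p_2 >= 1, and it is invariant because it depends on p_2
    only. *)
Definition cutoff x : R :=
  flat 0 (1 - power_sum 2 x)
  / (flat 0 (1 - power_sum 2 x) + flat 0 (power_sum 2 x - 2^-1)).

Lemma cutoff_den_gt0 x :
  0 < flat 0 (1 - power_sum 2 x) + flat 0 (power_sum 2 x - 2^-1).
Proof.
have [p|p] := ltP (power_sum 2 x) 1.
  by rewrite ltr_pwDl ?flat_ge0// flat_gt0 ?subr_gt0.
by rewrite ltr_wpDl ?flat_ge0// flat_gt0//; lra.
Qed.

Lemma elementary_cutoff : elementary cutoff.
Proof.
have e1 : elementary (fun x => flat 0 (1 - power_sum 2 x)).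
  have -> : (fun x => flat 0 (1 - power_sum 2 x)) =
      flat 0 \o (cst 1 + cst (-1) * power_sum 2).
    by apply/funext => x; rewrite !fctE /= mulN1r.
  apply: elementary_flat; apply: elementaryD; first exact: elementary_cst.
  by apply: elementaryM; [exact: elementary_cst|exact: elementary_power_sum].
have e2 : elementary (fun x => flat 0 (power_sum 2 x - 2^-1)).
  apply: (elementary_flat 0 (w := power_sum 2 + cst (- 2^-1))).
  by apply: elementaryD; [exact: elementary_power_sum|exact: elementary_cst].
apply: elementaryM => //; apply: elementaryV.
  by move=> x; rewrite gt_eqF// cutoff_den_gt0.
exact: elementaryD.
Qed.

Lemma power_sum_continuous n : continuous (power_sum n).
Proof.
by move=> x; apply: differentiable_continuous;
  exact: elementary_differentiable (elementary_power_sum n) x.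
Qed.

Lemma power_sum0 n : power_sum n.+1 0 = 0.
Proof. by apply: big1 => i _; rewrite mxE expr0n. Qed.

Lemma cutoff_near0 : \forall x \near (0 : 'rV[R]_d), cutoff x = 1.
Proof.
have : \forall x \near (0 : 'rV[R]_d), power_sum 2 x < 2^-1.
  have /cvgr_lt := @power_sum_continuous 2 0; apply.
  by rewrite power_sum0 invr_gt0.
apply: filterS => x px; rewrite /cutoff [X in _ / (_ + X)]flat_le0; last by lra.
by rewrite addr0 divff// gt_eqF// flat_gt0//; lra.
Qed.

Lemma cutoff_out x : 1 < `|x| -> cutoff x = 0.
Proof.
move=> x1; rewrite /cutoff flat_le0 ?mul0r// subr_le0.
have [i xi] : exists i, 1 < `|x 0 i|.
  apply: contrapT => H; move: x1; rewrite ltNge => /negP; apply.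
  apply: norm_le_coord => // i; rewrite leNgt; apply/negP => xi; apply: H.
  by exists i.
rewrite /power_sum (bigD1 i)//= ler_wpDr//.
  by apply: sumr_ge0 => j _; exact: sqr_ge0.
by rewrite -real_normK ?num_real// expr2; nra.
Qed.

(** All Hessian entries of p_1^2 are 2, and p_3 has only pure third derivatives, equal to 6. For
    distinct indices this one function therefore has all quadratic jets equal to 2 d and all cubic
    jets equal to 3. *)
Definition perturbation x : R :=
  (power_sum 1 x ^+ 2 + power_sum 3 x) * cutoff x.

Lemma elementary_perturbation : elementary perturbation.
Proof.
apply: elementaryM; last exact: elementary_cutoff.
apply: (elementaryD (w1 := power_sum 1 * power_sum 1));
  last exact: elementary_power_sum.
by apply: elementaryM; exact: elementary_power_sum.
Qed.

Lemma perturbation_invariant : Sd_invariant perturbation.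
Proof.
by move=> g x; rewrite /perturbation /cutoff !power_sum_col_perm.
Qed.

Lemma is_derive_power_sum n (i : 'I_d) x :
  is_derive x (delta_mx 0 i) (power_sum n.+1) (n.+1%:R * x 0 i ^+ n).
Proof.
have -> : power_sum n.+1 = \sum_(j < d) (fun x : 'rV[R]_d => x 0 j) ^+ n.+1.
  by apply/funext => y; rewrite fct_sumE; apply: eq_bigr => j _; rewrite exprfctE.
have D j := is_derive_coord i j x.
apply: is_derive_eq; rewrite (bigD1 i)//= big1 => [|j ji].
  by rewrite addr0 eqxx /GRing.scale /= mulr1.
by rewrite (negbTE ji) scaler0.
Qed.

Lemma perturbation_jets (i j k : 'I_d) :
  [/\ iter_partial [:: i] perturbation 0 = 0,
      iter_partial [:: j; i] perturbation 0 = 2 &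
      iter_partial [:: k; j; i] perturbation 0 = 6 * ((i == j) && (i == k))%:R].
Proof.
pose p x := power_sum 1 x ^+ 2 + power_sum 3 x.
have loc : \forall x \near (0 : 'rV[R]_d), perturbation x = p x.
  by apply: filterS cutoff_near0 => x cx; rewrite /perturbation cx mulr1.
have E s : iter_partial s perturbation 0 = iter_partial s p 0.
  exact: nbhs_singleton (near_partial s loc).
have p1 : partial i p = fun x => 2 * power_sum 1 x + 3 * x 0 i ^+ 2.
  apply/funext => x.
  have D1 := is_derive_power_sum 0 i x; have D3 := is_derive_power_sum 2 i x.
  have : is_derive x (delta_mx 0 i) (power_sum 1 ^+ 2 + power_sum 3)
      (2 * power_sum 1 x + 3 * x 0 i ^+ 2).
    apply: is_derive_eq (is_deriveD (is_deriveX 2 D1) D3) _.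
    by rewrite /GRing.scale /= expr0 expr1 !mulr1.
  by case.
have p2 : partial j (fun x => 2 * power_sum 1 x + 3 * x 0 i ^+ 2) =
    fun x => 2 + 6 * (i == j)%:R * x 0 i.
  apply/funext => x.
  have D1 := is_derive_power_sum 0 j x; have D3 := is_derive_coord j i x.
  have : is_derive x (delta_mx 0 j)
      (2 *: power_sum 1 + 3 *: (fun x : 'rV[R]_d => x 0 i) ^+ 2)
      (2 + 6 * (i == j)%:R * x 0 i).
    apply: is_derive_eq (is_deriveD (is_deriveZ 2 D1) (is_deriveZ 3 (is_deriveX 2 D3))) _.
    by rewrite /GRing.scale /= expr0 expr1; ring.
  by case.
have p3 : partial k (fun x => 2 + 6 * (i == j)%:R * x 0 i) =
    fun x => 6 * (i == j)%:R * (i == k)%:R.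
  apply/funext => x.
  have D3 := is_derive_coord k i x.
  have : is_derive x (delta_mx 0 k)
      (cst 2 + (6 * (i == j)%:R) *: (fun x : 'rV[R]_d => x 0 i))
      (6 * (i == j)%:R * (i == k)%:R).
    apply: is_derive_eq (is_deriveD (is_derive_cst (2 : R) x (delta_mx 0 k))
      (is_deriveZ (6 * (i == j)%:R) D3)) _.
    by rewrite add0r.
  by case.
rewrite !E /= !p1 !p2 p3 power_sum0 !mxE mulr0 expr0n /= !mulr0 !addr0.
by split => //; rewrite -mulrA -natrM mulnb.
Qed.

End Bump.

(** * Openness of the set of generic germs *)

Section GenericGerms.
Context {R : realType} {d : nat}.
Implicit Types (f g : invfun R d).

Lemma same_germ_jets f g (s : seq 'I_d) : same_germ f g ->
  iter_partial s f 0 = iter_partial s g 0.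
Proof. by move=> /asboolP H; exact: nbhs_singleton (near_partial s H). Qed.

(** The jets involve derivatives at 0 only, which the germ determines; hence the preimage of
    [generic_germs] is exactly the set of jet-generic functions. *)
Lemma jet_generic_same_germ f g : same_germ f g -> jet_generic f -> jet_generic g.
Proof.
move=> fg; have E s := same_germ_jets s fg.
have [qE cE] : quadratic_jet f = quadratic_jet g /\ cubic_jet f = cubic_jet g.
  split.
    apply/funext => i; apply/funext => j.
    have S : \sum_k iter_partial [:: k; j] f 0 = \sum_k iter_partial [:: k; j] g 0.
      by apply: eq_bigr => k _; exact: (E [:: k; j]).
    exact: congr2 (congr2 _ S (congr1 _ (E [:: i; i]))) (E [:: j; i]).
  apply/funext => i; apply/funext => j; apply/funext => k.
  rewrite /cubic_jet (E [:: i; i; i]) (E [:: i; j; i]).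
  by rewrite (E [:: j; i; i]) (E [:: j; j; i]) (E [:: k; i; i]) (E [:: k; j; i]).
by rewrite /jet_generic qE cE.
Qed.

Definition generic_germs : set (invgerm R d) :=
  @germ_of R d @` [set f : invfun R d | jet_generic f].

Lemma germ_of_generic f : generic_germs (germ_of f) <-> jet_generic f.
Proof.
split=> [[g gg /eqmodP gf]|]; last by exists f.
exact: jet_generic_same_germ gf gg.
Qed.

Lemma quadratic_jet_close f g (i j : 'I_d) (e : R) :
  (forall s : seq 'I_d, (size s <= 3)%N ->
     `|iter_partial s g 0 - iter_partial s f 0| <= e) ->
  `|quadratic_jet g i j - quadratic_jet f i j| <= d%:R * e + 2 * e.
Proof.
move=> H.
have -> : quadratic_jet g i j - quadratic_jet f i j =
   \sum_k (iter_partial [:: k; j] g 0 - iter_partial [:: k; j] f 0)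
   - (iter_partial [:: i; i] g 0 - iter_partial [:: i; i] f 0)
   + (iter_partial [:: j; i] g 0 - iter_partial [:: j; i] f 0).
  rewrite sumrB /quadratic_jet.
  have alg (a b c a' b' c' : R) :
    a - b + c - (a' - b' + c') = a - a' - (b - b') + (c - c') by ring.
  exact: alg.
have h1 := H [:: i; i] isT; have h2 := H [:: j; i] isT.
have h3 : `|\sum_k (iter_partial [:: k; j] g 0 - iter_partial [:: k; j] f 0)| <= d%:R * e.
  rewrite (le_trans (ler_norm_sum _ _ _))//.
  rewrite (le_trans (ler_sum _ (fun k _ => H [:: k; j] isT)))//.
  by rewrite sumr_const card_ord mulr_natl.
rewrite (le_trans (ler_normD _ _))// (le_trans (lerD (ler_normB _ _) (lexx _)))//.
by rewrite (mulr_natl e 2) mulr2n addrA; exact: lerD (lerD h3 h1) h2.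
Qed.

Lemma cubic_jet_close f g (i j k : 'I_d) (e : R) :
  (forall s : seq 'I_d, (size s <= 3)%N ->
     `|iter_partial s g 0 - iter_partial s f 0| <= e) ->
  `|cubic_jet g i j k - cubic_jet f i j k| <= 4 * e.
Proof.
move=> H.
have := H [:: i; i; i] isT; have := H [:: i; j; i] isT.
have := H [:: j; i; i] isT; have := H [:: j; j; i] isT.
have := H [:: k; i; i] isT; have := H [:: k; j; i] isT.
rewrite /cubic_jet.
do 6 move: (iter_partial _ g 0) (iter_partial _ f 0) => ? ?.
rewrite !ler_norml; lra.
Qed.

(** Genericity is the nonvanishing of finitely many linear forms in the 3-jet at 0, so a C^3
    neighbourhood of constant radius suffices. *)
Lemma open_generic_germs : open generic_germs.
Proof.
have E : @germ_of R d @^-1` generic_germs = [set f : invfun R d | jet_generic f].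
  by apply/seteqP; split=> f /=; rewrite germ_of_generic.
(* Open in the quotient topology means that the preimage under [germ_of] is Whitney open. *)
change (open (@germ_of R d @^-1` generic_germs)); rewrite E.
change (whitney_open [set f : invfun R d | jet_generic f]).
move=> f [q0 c0].
have near_lt (c a : R) : a != 0 -> \forall e \near (0 : R)^'+, c * e < `|a|.
  move=> a0.
  near=> e.
  have e0 : 0 < e by near: e; exact: nbhs_right_gt.
  have e1 : e < `|a| / (`|c| + 1).
    by near: e; apply: nbhs_right_lt; rewrite divr_gt0 ?normr_gt0// ltr_wpDl.
  move: e1; rewrite ltr_pdivlMr ?ltr_wpDl// => /(le_lt_trans _); apply.
  by rewrite mulrC ler_pM2l// (le_trans (ler_norm c))// lerDl.
have H1 (i j : 'I_d) : \forall e \near (0 : R)^'+, i != j ->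
    d%:R * e + 2 * e < `|quadratic_jet f i j|.
  have [ij|_] := boolP (i != j); last by near=> e.
  have H := near_lt (d%:R + 2) _ (q0 i j ij).
  by near=> e => _; rewrite -mulrDl; near: e; exact: H.
have H2 (i j k : 'I_d) : \forall e \near (0 : R)^'+, i != j -> i != k -> j != k ->
    4 * e < `|cubic_jet f i j k|.
  have [ij|_] := boolP (i != j); last by near=> e.
  have [ik|_] := boolP (i != k); last by near=> e.
  have [jk|_] := boolP (j != k); last by near=> e.
  have H := near_lt 4 _ (c0 i j k ij ik jk).
  by near=> e => _ _ _; near: e; exact: H.
have H1' : \forall e \near (0 : R)^'+, forall i j : 'I_d, i != j ->
    d%:R * e + 2 * e < `|quadratic_jet f i j|.
  exact: (@filter_forall _ _ _ _ _ (fun i => @filter_forall _ _ _ _ _ (H1 i))).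
have H2' : \forall e \near (0 : R)^'+, forall i j k : 'I_d,
    i != j -> i != k -> j != k -> 4 * e < `|cubic_jet f i j k|.
  exact: (@filter_forall _ _ _ _ _ (fun i => @filter_forall _ _ _ _ _ (fun j =>
    @filter_forall _ _ _ _ _ (H2 i j)))).
(* d e + 2 e and 4 e bound the changes of the two jets when the derivatives at 0 move by at most e;
   the index tuples being finite in number, one e serves all. *)
have [e [e0 Hq Hc]] : exists e : R, [/\ 0 < e,
    forall i j : 'I_d, i != j -> d%:R * e + 2 * e < `|quadratic_jet f i j| &
    forall i j k : 'I_d, i != j -> i != k -> j != k -> 4 * e < `|cubic_jet f i j k|].
  near ((0 : R)^'+) => e; exists e; split; near: e;
    [exact: nbhs_right_gt|exact: H1'|exact: H2'].
exists 3%N, (cst e); split.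
- exact: cst_continuous.
- by [].
move=> g gf.
have close s : (size s <= 3)%N -> `|iter_partial s g 0 - iter_partial s f 0| <= e.
  by move=> s3; apply: ltW; exact: (gf s s3 0).
split=> [i j ij|i j k ij ik jk].
  have := quadratic_jet_close i j close.
  apply: contraTneq => ->; rewrite sub0r normrN -ltNge; exact: Hq.
have := cubic_jet_close i j k close.
apply: contraTneq => ->; rewrite sub0r normrN -ltNge; exact: Hc.
Unshelve. all: by end_near. Qed.

End GenericGerms.

(** * Density of the set of generic germs *)

Section Density.
Context {R : realType} {d : nat}.
Implicit Types (w : 'rV[R]_d -> R) (x : 'rV[R]_d) (f : invfun R d).

(** Outside the unit ball w and its derivatives vanish, and on that compact ball the quotient of
    each by delta attains a maximum; the decay of delta at infinity does no harm. *)
Lemma elementary_dominated w (delta : 'rV[R]_d -> R) (r : nat) :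
  elementary w -> (forall x, 1 < `|x| -> w x = 0) ->
  continuous delta -> (forall x, 0 < delta x) ->
  exists2 M, 0 < M & forall s : seq 'I_d, (size s <= r)%N ->
    forall x, `|iter_partial s w x| <= M * delta x.
Proof.
move=> + + cd d0; elim: r w => [|r IH] w ew w0.
  have cw : continuous (fun x => `|w x| / delta x).
    move=> x; have cwx : {for x, continuous w}.
      exact/differentiable_continuous/elementary_differentiable.
    exact: (cvgM (cvg_norm cwx) (cvgV (lt0r_neq0 (d0 x)) (cd x))).
  pose A := [set x : 'rV[R]_d | `|x| <= 1].
  have A0 : A !=set0 by exists 0; rewrite /A /= normr0.
  have cA : compact A.
    apply: bounded_closed_compact.
      by exists 1; split => // M M1 x /= xA; exact: le_trans xA (ltW M1).
    have -> : A = (fun x : 'rV[R]_d => `|x|) @^-1` [set y | y <= 1] by [].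
    apply: closed_comp; last exact: closed_le.
    by move=> x _; exact: norm_continuous.
  have [c cA' cmax] := compact_EVT_max A0 cA (continuous_subspaceT cw).
  exists (`|w c| / delta c + 1).
    by rewrite ltr_wpDl// divr_ge0// ltW.
  move=> [|//] _ x /=; rewrite -ler_pdivrMr//.
  have [x1|x1] := leP `|x| 1.
    have := cmax x; rewrite inE => /(_ x1) /le_trans; apply.
    by rewrite lerDl.
  by rewrite w0// normr0 mul0r addr_ge0// divr_ge0// ltW.
have out i x : 1 < `|x| -> partial i w x = 0.
  move=> x1; have -> : partial i w x = partial i (cst 0) x.
    apply: near_eq_derive.
    have : \forall y \near x, 1 < `|y|.
      have /cvgr_gt := @norm_continuous _ _ x; exact.
    by apply: filterS => y /w0.
  exact: derive_cst.
have [M0 M00 H0] := IH w ew w0.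
have /choice[M HM] i : exists M, 0 < M /\ forall s : seq 'I_d, (size s <= r)%N ->
    forall x, `|iter_partial s (partial i w) x| <= M * delta x.
  by have [M M1 HM] := IH (partial i w) (elementary_partial i ew) (out i); exists M.
have M_ge0 : 0 <= \sum_i M i by apply: sumr_ge0 => i _; have [/ltW] := HM i.
exists (M0 + \sum_i M i); first by rewrite ltr_pwDl.
(* The last entry of the list is the derivative taken first, so the induction hypothesis applies to
   [partial i w]. *)
case/lastP => [|s i] sr x.
  rewrite (le_trans (H0 [::] _ x))// ler_pM2r// lerDl//.
have -> : iter_partial (rcons s i) w = iter_partial s (partial i w).
  by rewrite /iter_partial foldr_rcons.
rewrite size_rcons ltnS in sr.
rewrite (le_trans ((HM i).2 s sr x))// ler_pM2r// (bigD1 i)//= addrCA lerDl.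
by rewrite addr_ge0 ?(ltW M00)//; apply: sumr_ge0 => j _; have [/ltW] := HM j.
Qed.

Lemma invfun_perturb f (e : R) :
  exists g : invfun R d, invfun_val g = f \+ e \*: perturbation.
Proof.
have sv : smooth (@perturbation R d) := elementary_smooth elementary_perturbation.
have sf := invfun_smooth f.
have sg : smooth (f \+ e \*: perturbation) by apply: smoothD => //; exact: smoothZ.
have gS : Sd_invariant (f \+ e \*: perturbation).
  by move=> g x; rewrite /= perturbation_invariant (invfun_inv f).
have g0 : (f \+ e \*: perturbation) 0 = 0.
  rewrite /= invfun_0 /perturbation !power_sum0 expr0n /= addr0 mul0r.
  by rewrite scaler0 addr0.
have dg i : partial i (f \+ e \*: perturbation) 0 = 0.
  have := iter_partialD [:: i] sf (smoothZ e sv).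
  rewrite iter_partialZ// => /(congr1 (fun h => h 0)) /= ->.
  rewrite (invfun_d0 f); have [h _ _] := @perturbation_jets R d i i i.
  by rewrite /= in h; rewrite h scaler0 addr0.
by exists (Defs.InvFun sg gS g0 dg).
Qed.

Lemma perturb_jets f (g : 'rV[R]_d -> R) (e : R) (s : seq 'I_d) :
  g = f \+ e \*: perturbation ->
  iter_partial s g =
    fun x => iter_partial s f x + e * iter_partial s perturbation x.
Proof.
have sv : smooth (@perturbation R d) := elementary_smooth elementary_perturbation.
move=> ->; rewrite iter_partialD ?iter_partialZ//; first exact: invfun_smooth.
exact: smoothZ.
Qed.

Lemma perturb_quadratic f g (e : R) (i j : 'I_d) :
  invfun_val g = f \+ e \*: perturbation -> i != j ->
  quadratic_jet g i j = quadratic_jet f i j + e * (2 * d%:R).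
Proof.
move=> gE ij; rewrite /quadratic_jet.
have J a b : iter_partial [:: a; b] g 0 = iter_partial [:: a; b] f 0 + e * 2.
  by rewrite (perturb_jets _ gE); have [_ -> _] := @perturbation_jets R d b a a.
have S : \sum_k iter_partial [:: k; j] g 0 =
    \sum_k iter_partial [:: k; j] f 0 + e * 2 * d%:R.
  transitivity (\sum_(k < d) (iter_partial [:: k; j] f 0 + e * 2)).
    by apply: eq_bigr => k _; exact: J.
  rewrite big_split /= sumr_const card_ord.
  by rewrite -[_ *+ d]mulr_natr.
have alg (a b c a' b' c' : R) : a' = a + e * 2 * d%:R -> b' = b + e * 2 ->
  c' = c + e * 2 -> a' - b' + c' = a - b + c + e * (2 * d%:R).
  by move=> -> -> ->; ring.
exact: alg S (J i i) (J j i).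
Qed.

Lemma perturb_cubic f g (e : R) (i j k : 'I_d) :
  invfun_val g = f \+ e \*: perturbation -> i != j -> i != k -> j != k ->
  cubic_jet g i j k = cubic_jet f i j k + e * 3.
Proof.
move=> gE ij ik jk; rewrite /cubic_jet.
have J a b c : iter_partial [:: a; b; c] g 0 =
    iter_partial [:: a; b; c] f 0 + e * (6 * ((c == b) && (c == a))%:R).
  by rewrite (perturb_jets _ gE); have [_ _ ->] := @perturbation_jets R d c b a.
rewrite (J i i i) (J i j i) (J j i i) (J j j i) (J k i i) (J k j i).
move: (iter_partial [:: i; i; i] f 0) (iter_partial [:: i; j; i] f 0)
  (iter_partial [:: j; i; i] f 0) (iter_partial [:: j; j; i] f 0)
  (iter_partial [:: k; i; i] f 0) (iter_partial [:: k; j; i] f 0) => a b c a' b' c'.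
by rewrite !eqxx (negbTE ij) (negbTE ik) /=; field.
Qed.

(** An affine function of nonzero slope has a single zero, which small positive e avoid even if that
    zero is 0. *)
Lemma near_avoid (a b : R) : b != 0 -> \forall e \near (0 : R)^'+, a + e * b != 0.
Proof.
move=> b0; have [->|a0] := eqVneq a 0.
  near=> e; have e0 : 0 < e by near: e; exact: nbhs_right_gt.
  by rewrite add0r mulf_neq0// gt_eqF.
near=> e.
have e0 : 0 < e by near: e; exact: nbhs_right_gt.
have e1 : e < `|a| / `|b|.
  by near: e; apply: nbhs_right_lt; rewrite divr_gt0 ?normr_gt0.
move: e1; rewrite ltr_pdivlMr ?normr_gt0// -{1}(gtr0_norm e0) -normrM.
apply: contraTneq => /eqP; rewrite addrC addr_eq0 => /eqP ->.
by rewrite normrN ltxx.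
Unshelve. all: by end_near. Qed.

Lemma dense_generic_germs : (0 < d)%N -> dense (@generic_germs R d).
Proof.
move=> dpos O [u Ou] oO.
pose f : invfun R d := generic_quotient.repr u.
have Of : (@germ_of R d @^-1` O) f by rewrite /= /germ_of generic_quotient.reprK.
have oW : whitney_open (@germ_of R d @^-1` O) by exact: oO.
have [r [delta [cd d0 sub]]] := oW f Of.
have v_out x : 1 < `|x| -> perturbation x = 0.
  by move=> x1; rewrite /perturbation cutoff_out ?mulr0.
have [M M0 HM] := elementary_dominated r elementary_perturbation v_out cd d0.
(* The slope 2 d is nonzero because d > 0. *)
have H1 (i j : 'I_d) : \forall e \near (0 : R)^'+,
    quadratic_jet f i j + e * (2 * d%:R) != 0.
  by apply: near_avoid; rewrite mulf_neq0// pnatr_eq0 -lt0n.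
have H2 (i j k : 'I_d) : \forall e \near (0 : R)^'+,
    cubic_jet f i j k + e * 3 != 0.
  by apply: near_avoid.
have H1' : \forall e \near (0 : R)^'+, forall i j : 'I_d,
    quadratic_jet f i j + e * (2 * d%:R) != 0.
  exact: (@filter_forall _ _ _ _ _ (fun i => @filter_forall _ _ _ _ _ (H1 i))).
have H2' : \forall e \near (0 : R)^'+, forall i j k : 'I_d,
    cubic_jet f i j k + e * 3 != 0.
  exact: (@filter_forall _ _ _ _ _ (fun i => @filter_forall _ _ _ _ _ (fun j =>
    @filter_forall _ _ _ _ _ (H2 i j)))).
(* e < 1 / M keeps e times the perturbation strictly below delta in all derivatives up to order r,
   while the last two conditions make the jets of the perturbed function nonzero. *)
have [e [e0 eM Hq Hc]] : exists e : R, [/\ 0 < e, e < M^-1,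
    forall i j : 'I_d, quadratic_jet f i j + e * (2 * d%:R) != 0 &
    forall i j k : 'I_d, cubic_jet f i j k + e * 3 != 0].
  near ((0 : R)^'+) => e; exists e; split; near: e;
    [exact: nbhs_right_gt| |exact: H1'|exact: H2'].
  by apply: nbhs_right_lt; rewrite invr_gt0.
have [g gE] := invfun_perturb f e.
exists (germ_of g); split.
  apply: sub => s sr x.
  rewrite (perturb_jets s gE) addrC addKr normrM (gtr0_norm e0).
  rewrite (le_lt_trans (ler_wpM2l (ltW e0) (HM s sr x)))// mulrA.
  by rewrite -[ltRHS]mul1r ltr_pM2r// -ltr_pdivlMr// div1r.
apply/germ_of_generic; split=> [i j ij|i j k ij ik jk].
  by rewrite (perturb_quadratic gE).
by rewrite (perturb_cubic gE).
Unshelve. all: by end_near. Qed.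

End Density.

Theorem theorem5p9 (R : realType) :
  exists C : R, forall d : nat, (0 < d)%N ->
  exists U : set (invgerm R d),
    [/\ open U, dense U &
    forall f : invfun R d, U (germ_of f) ->
      (exists (N : nat) (eps : 'I_N -> R) (gamma : 'I_N -> R -> 'rV[R]_d),
         [/\ N%:R <= C ^+ d,
             forall k, tangency_arc f (eps k) (gamma k)
           & germ_consists_of_arcs (tangency_set f) eps gamma]) /\
      (forall (eps : R) (gamma : R -> 'rV[R]_d), tangency_arc f eps gamma ->
         exists (q : nat) (s : 'S_d),
           (q <= d./2)%N /\ arc_isotropy gamma (young d q :^ s)%g)].
Proof.
(* The base 2 comes from one arc for each subset of the d coordinates. *)
exists 2 => d dpos; exists (@generic_germs R d); split.
- exact: open_generic_germs.
- exact: dense_generic_germs.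
move=> f /germ_of_generic gf.
pose i0 : 'I_d := Ordinal dpos.
have sf := invfun_smooth f; have fS := invfun_inv f; have f0 := invfun_d0 f.
split; first exact: generic_tangency_arcs i0 sf fS f0 gf.
move=> eps gamma ta.
have [q [s [qd iso]]] := arc_isotropy_young i0 sf fS f0 gf ta.
by exists q, s; split.
Qed.
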